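(* Let $t,n\in\mathbb{N}$ with $n\geq2$, and assume that $n-1$ is even or prime. Then the complete graph $K_n$ on $n$ vertices satisfies $$\chi_{\mathrm{OL}}^t(K_n)\,=\,\begin{cases} n+2t-1&\text{if } n \text{ is even,}\\ n+2t&\text{if } n \text{ is odd.}\end{cases}$$
   Context: $\mathbb{N}=\{0,1,2,\dots\}$. Let $G=(V,E)$ be a finite graph. For $t\colon V\to\mathbb{N}$ (a number $t\in\mathbb{N}$ being regarded as a constant function) let $\operatorname{supp}(t)=\{v\in V : t(v)\neq0\}$; for $U\subseteq V$ let $\mathsf{1}_U\colon V\to\{0,1\}$ be the indicator function of $U$. A set of edges is independent if its members are pairwise disjoint (no two share an end). $G-U$ is obtained by deleting the vertices in $U$ and all edges incident with them; $G-F$ by deleting the edges in $F$ (keeping all vertices). For $m\in\mathbb{N}$, being on-line $t$-avoiding edge $m$-colorable is defined recursively: (i) if $m=0$, then $G$ is on-line $t$-avoiding edge $m$-colorable if $E=\emptyset$; (ii) if $m>0$, then $G$ is on-line $t$-avoiding edge $m$-colorable if for every subset $U\subseteq\operatorname{supp}(t)$ there exists an independent subset $F\subseteq E(G-U)$ such that $G-F$ is on-line $(t-\mathsf{1}_U)$-avoiding edge $(m-1)$-colorable. The on-line $t$-avoiding chromatic index $\chi_{\mathrm{OL}}^t(G)$ is the smallest $m\in\mathbb{N}$ such that $G$ is on-line $t$-avoiding edge $m$-colorable. *)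

(* Defs.v *)
From mathcomp Require Import all_boot.

Set Implicit Arguments.
Unset Strict Implicit.
Unset Printing Implicit Defensive.

(* Finite simple graphs on the vertex set V; an edge is the 2-element set of
   its two ends. *)
Record graph (V : finType) := Graph {
  edges : {set {set V}};
  edgesP : [forall e in edges, #|e| == 2] }.

Section OnLine.
Variable V : finType.
Implicit Types (G : graph V) (U : {set V}) (F : {set {set V}}) (t : V -> nat).

(* E(G - U); the graph G - U itself, which has fewer vertices, is only ever
   used through its edge set. *)
Definition edges_delv G U : {set {set V}} :=
  [set e in edges G | [disjoint e & U]].

Lemma dele_subproof G F : [forall e in edges G :\: F, #|e| == 2].
Proof.
apply/forall_inP=> e /setDP[eG _].
exact: (forall_inP (edgesP G)).
Qed.

(* G - F *)
Definition dele G F : graph V := Graph (dele_subproof G F).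

Definition supp t : {set V} := [set v | t v != 0].

(* t - 1_U; the truncation of the subtraction is harmless for U \subset supp t *)
Definition subind t U : V -> nat := fun v => t v - (v \in U).

Fixpoint online_colorable (m : nat) (t : V -> nat) (G : graph V) : bool :=
  if m is m'.+1 then
    [forall (U : {set V} | U \subset supp t),
      exists F : {set {set V}},
        [&& F \subset edges_delv G U, trivIset F
          & online_colorable m' (subind t U) (dele G F)]]
  else edges G == set0.

Lemma trivIset0 : trivIset (set0 : {set {set V}}).
Proof. by apply/trivIsetP=> A B; rewrite inE. Qed.

Lemma online_colorable_noedge m t G : edges G = set0 -> online_colorable m t G.
Proof.
elim: m t G => [|m IHm] t G G0 /=; first by rewrite G0.
apply/forall_inP=> U _; apply/existsP; exists set0.
by rewrite sub0set trivIset0 IHm //= G0 set0D.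
Qed.

Lemma online_colorable_large m t G :
  \sum_v t v + #|edges G| <= m -> online_colorable m t G.
Proof.
elim: m t G => [|m IHm] t G le_m.
  by move: le_m; rewrite leqn0 addn_eq0 cards_eq0 => /andP[].
have [G0 | [e eG]] := set_0Vmem (edges G); first exact: online_colorable_noedge.
apply/forall_inP=> U sUt.
have le_t v : subind t U v <= t v by rewrite leq_subr.
apply/existsP; have [U0 | [u uU]] := set_0Vmem U.
  exists [set e]; apply/and3P; split.
  - by rewrite sub1set inE eG U0 disjoint_sym -setI_eq0 set0I eqxx.
  - by apply/trivIsetP=> A B /set1P-> /set1P->; rewrite eqxx.
  apply: IHm; rewrite -ltnS; apply: leq_trans le_m.
  rewrite -addnS leq_add //; first exact: leq_sum.
  by rewrite [X in _ <= X](cardsD1 e) eG.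
exists set0; rewrite sub0set trivIset0 /=.
apply: IHm; rewrite /= setD0 -ltnS; apply: leq_trans le_m.
rewrite -addSn leq_add2r (bigD1 u) //= [X in _ < X](bigD1 u) //= -addSn.
rewrite leq_add //; last exact: leq_sum.
have := subsetP sUt u uU; rewrite inE -lt0n => tu.
by rewrite /subind uU subn1 prednK.
Qed.

Lemma online_colorable_ex t G : exists m, online_colorable m t G.
Proof. by eexists; apply: online_colorable_large; apply: leqnn. Qed.

Definition chi_OL t G : nat := ex_minn (online_colorable_ex t G).

End OnLine.

Lemma complete_subproof n :
  [forall e in [set e : {set 'I_n} | #|e| == 2], #|e| == 2].
Proof. by apply/forall_inP=> e; rewrite inE. Qed.

Definition complete n : graph 'I_n := Graph (complete_subproof n).

(* Main.v *)
Require Import Defs.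
From mathcomp Require Import all_boot all_order all_fingroup all_algebra all_solvable all_field.
From mathcomp Require Import mpoly zify ring.

Set Implicit Arguments.
Unset Strict Implicit.
Unset Printing Implicit Defensive.

(* Both lower bounds come from an adversary who has one vertex avoid t times
   alone and then all other vertices avoid t times together; for n odd he first
   plays the empty set, so that some vertex is missed.

   For the upper bounds, let P be the product of the differences x_e - x_f over
   the pairs of adjacent edges of K_n.  If the coefficient of x^d in P is
   nonzero and d(e) + t(u) + t(v) < m for all edges e = uv, then the painter
   survives one more round with the corresponding invariant (Schauz's paintability
   version of the Alon-Tarsi theorem), so it suffices to find such a d with
   d(e) < n (n odd) or d(e) < n - 1 (n - 1 prime).  Such coefficients are
   evaluated by Lagrange interpolation on a grid and become signed sums over
   symmetric Latin squares a of odd order.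

   For n odd, adding the weights t_c = T^c leaves the sum of sign(a) T^w(a), with
   w(a) the sum of the entries of a above the antidiagonal; the lowest power of T
   is attained by the anticyclic square only.

   For n = p + 1, edges at the additional vertex become diagonal entries, and the
   sum is p! times the signed sum over idempotent symmetric squares.  Modulo p only
   the squares a(i,j) = i + f(j - i) fixed by the translations of Z/p survive.  Their
   signed sum is, up to a unit, a sum over (F_p)^((p-1)/2) of a product of affine
   forms of top degree, hence depends only on the linear parts of the forms; it is
   Dyson's constant term for exponent 2, and shifting the forms leaves one nonzero
   term. *)

Lemma sum_leq_eq (I : finType) (F G : I -> nat) :
  (forall i, F i <= G i) -> \sum_i G i <= \sum_i F i -> F =1 G.
Proof.
move=> le sum i; apply/eqP; rewrite eqn_leq le /= -subn_eq0.
have : \sum_j (G j - F j) == 0 by rewrite sumnB // subn_eq0.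
by rewrite sum_nat_eq0 => /forallP/(_ i).
Qed.

(** * The conflict polynomial and the painting step *)

Section ConflictPolynomial.
Import GRing.Theory.
Local Open Scope ring_scope.
Variables (R : comNzRingType) (T : finType).
Implicit Types (s : seq (T * T)) (F W : {set T}) (P : {mpoly R[#|T|]}).
Implicit Types (m d : 'X_{1..#|T|}) (e : T).

Definition mvar e : {mpoly R[#|T|]} := 'X_(enum_rank e).

Definition cpoly s : {mpoly R[#|T|]} := \prod_(q <- s) (mvar q.1 - mvar q.2).

Lemma msupp_mvarB q m : m \in msupp (mvar q.1 - mvar q.2) -> mdeg m = 1%N.
Proof.
move/msuppB_le; rewrite mem_cat /mvar !msuppX !inE.
by case/orP=> /eqP->; rewrite mdeg1.
Qed.

Lemma mdeg_cpoly s m : m \in msupp (cpoly s) -> mdeg m = size s.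
Proof.
rewrite /cpoly; elim: s m => [|q s IHs] m.
  by rewrite big_nil msupp1 inE => /eqP->; rewrite mdeg0.
rewrite big_cons => /msuppM_le /allpairsP [[m1 m2] /= [m1P m2P ->]].
by rewrite mdegD (msupp_mvarB m1P) (IHs _ m2P).
Qed.

Lemma mcoeffM_neq0 P Q m : (P * Q)@_m != 0 ->
  exists m1 m2, [/\ m = (m1 + m2)%MM, P@_m1 != 0 & Q@_m2 != 0].
Proof.
rewrite -mcoeff_msupp => /msuppM_le /allpairsP [[m1 m2] /= [m1P m2P ->]].
by exists m1, m2; rewrite -!mcoeff_msupp.
Qed.

(* The exponents of the variables in [Wl] are bounded below by [dl], those in
   [F] are free, and all others are prescribed by [dl]. *)
Definition expmatch (Wl : seq T) F (dl : T -> nat) m : bool :=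
  [forall e, if e \in Wl then (dl e <= m (enum_rank e))%N
             else (e \in F) || (m (enum_rank e) == dl e)].

Definition coefsum Wl F dl P : R :=
  \sum_(m <- msupp P) P@_m *+ expmatch Wl F dl m.

Definition upd (dl : T -> nat) w k : T -> nat :=
  fun e => if e == w then k else dl e.

(** The exponent of [w] either reaches [dl w] or equals exactly one [k < dl w]; freeing [w] merges
    these cases. *)
Lemma expmatch_cons w Wl F dl m : w \notin Wl -> w \notin F ->
  (expmatch (w :: Wl) F dl m + \sum_(k < dl w) expmatch Wl F (upd dl w k) m =
   expmatch Wl (w |: F) dl m)%N.
Proof.
move=> wWl wF.
pose rest := [forall e, (e != w) ==> if e \in Wl then (dl e <= m (enum_rank e))%N
             else (e \in F) || (m (enum_rank e) == dl e)].
have E1 : expmatch (w :: Wl) F dl m = (dl w <= m (enum_rank w))%N && rest.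
  apply/forallP/andP => [H|[H1 /forallP H2] e].
    split; first by have := H w; rewrite inE eqxx.
    by apply/forallP=> e; apply/implyP=> ew; have := H e; rewrite inE (negPf ew).
  rewrite inE; case: eqVneq => [->//|ew] /=.
  by have := H2 e; rewrite ew.
have E2 k : expmatch Wl F (upd dl w k) m = (m (enum_rank w) == k) && rest.
  apply/forallP/andP => [H|[H1 /forallP H2] e].
    split; first by have := H w; rewrite /upd (negPf wWl) (negPf wF) eqxx.
    apply/forallP=> e; apply/implyP=> ew; have := H e.
    by rewrite /upd (negPf ew).
  have := H2 e; rewrite /upd; case: eqVneq => [->|//] _.
  by rewrite (negPf wWl) H1 orbT.
have E3 : expmatch Wl (w |: F) dl m = rest.
  apply/forallP/forallP => H e.
    by apply/implyP=> ew; have := H e; rewrite !inE (negPf ew).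
  have := H e; rewrite !inE; case: eqVneq => [->|//] _.
  by rewrite (negPf wWl).
rewrite E1 E3; under eq_bigr do rewrite E2.
case: rest {E1 E2 E3}; rewrite ?andbT ?andbF; last first.
  by rewrite big1 // => i _; rewrite andbF.
under eq_bigr do rewrite andbT.
case: leqP => [le|lt] /=.
  rewrite big1 ?addn0 // => i _.
  by case: eqP => // E; have := ltn_ord i; rewrite -E ltnNge le.
rewrite (bigD1 (Ordinal lt)) //= eqxx big1 // => i ni.
by case: eqP => // E; case/eqP: ni; apply: val_inj.
Qed.

(** The elements of [Wl] are decided one at a time. By [expmatch_cons], a nonzero sum with a lower
    bound at [w] forces either a nonzero sum with [w] free, and [w] joins [F'], or a nonzero sum
    with the exponent of [w] fixed below [dl w], and [w] stays out of [F']. *)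
Lemma coefsum_select Wl F dl P : uniq Wl -> (forall w, w \in Wl -> w \notin F) ->
  coefsum Wl F dl P != 0 ->
  exists F' dl', [/\ F \subset F', (forall e, e \in F' -> (e \in F) || (e \in Wl)),
    (forall e, e \notin F' -> (dl' e + (e \in Wl) <= dl e)%N) &
    coefsum [::] F' dl' P != 0].
Proof.
elim: Wl F dl => [|w Wl IH] F dl /=.
  by move=> _ _ nz; exists F, dl; split=> // e; rewrite ?addn0 // => ->.
move=> /andP[wWl uWl] dis nz.
have wF : w \notin F by apply: dis; rewrite mem_head.
have dis' v : v \in Wl -> v \notin F by move=> vW; apply: dis; rewrite inE vW orbT.
have E : coefsum (w :: Wl) F dl P + \sum_(k < dl w) coefsum Wl F (upd dl w k) P
   = coefsum Wl (w |: F) dl P.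
  rewrite /coefsum exchange_big -big_split /=; apply: eq_bigr => m _.
  by rewrite -(expmatch_cons _ _ wWl wF) mulrnDr -sumrMnr.
have [z|nz'] := eqVneq (coefsum Wl (w |: F) dl P) 0.
  have /existsP[k nzk] : [exists k : 'I_(dl w), coefsum Wl F (upd dl w k) P != 0].
    apply: contraR nz => /existsPn H; move: E.
    by rewrite z big1 ?addr0 => [->//|k _]; apply/eqP; have := H k; rewrite negbK.
  have [F' [dl' [sF H1 H2 H3]]] := IH _ _ uWl dis' nzk.
  exists F', dl'; split=> // e eF'.
    by rewrite inE orbCA H1 ?orbT.
  have := H2 e eF'; rewrite /upd inE; case: eqVneq => [->|//] /=.
  by rewrite (negPf wWl) addn0 addn1 => /leq_ltn_trans; apply.
have dis2 v : v \in Wl -> v \notin w |: F.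
  by move=> vW; rewrite !inE negb_or dis' // andbT; apply: contraNneq wWl => <-.
have [F' [dl' [sF H1 H2 H3]]] := IH _ _ uWl dis2 nz'.
have wF' : w \in F' by rewrite (subsetP sF) // setU11.
exists F', dl'; split=> [||e eF'|//].
- by apply: subset_trans sF; apply: subsetUr.
- by move=> e /H1; rewrite !inE -orbA orbCA.
have ew : e != w by apply: contraNneq eF' => ->.
by have := H2 e eF'; rewrite inE (negPf ew).
Qed.

Definition restrict0 F (dl : T -> nat) : 'X_{1..#|T|} :=
  [multinom if enum_val i \in F then 0%N else dl (enum_val i) | i < #|T|].

Definition spec1 F : #|T|.-tuple {mpoly R[#|T|]} :=
  [tuple if enum_val i \in F then 1 else 'X_i | i < #|T|].

(** Setting the variables in [F] to 1 merges the monomials that differ only in their exponents on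
    [F]. *)
Lemma coefsum_spec1 F dl P :
  coefsum [::] F dl P = (P \mPo spec1 F)@_(restrict0 F dl).
Proof.
rewrite comp_mpolyEX raddf_sum /=; apply: eq_bigr => m _.
rewrite mcoeffZ comp_mpolyX.
have -> : \prod_(i < #|T|) tnth (spec1 F) i ^+ m i =
    'X_[restrict0 F (fun e => m (enum_rank e))].
  rewrite mpolyXE_id; apply: eq_bigr => i _.
  rewrite tnth_mktuple mnmE enum_valK.
  by case: ifP; rewrite ?expr1n ?expr0.
rewrite mcoeffX mulr_natr; congr (_ *+ nat_of_bool _).
apply/forallP/eqP => [H|/mnmP H e].
  apply/mnmP => i; rewrite !mnmE enum_valK.
  have := H (enum_val i); rewrite enum_valK; by case: ifP => //= _ /eqP.
have := H (enum_rank e); rewrite !mnmE enum_rankK.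
by case: ifP => //= _ ->.
Qed.

Definition del_pairs F s := [seq q <- s | (q.1 \notin F) && (q.2 \notin F)].

Lemma cpoly_split s p : cpoly s = cpoly [seq q <- s | p q] * cpoly [seq q <- s | ~~ p q].
Proof. by rewrite /cpoly !big_filter (bigID p). Qed.

Lemma mvar_spec1 F e : mvar e \mPo spec1 F = if e \in F then 1 else mvar e.
Proof.
by rewrite comp_mpolyXU -tnth_nth tnth_mktuple enum_rankK.
Qed.

Lemma cpoly_spec1 F s : cpoly s \mPo spec1 F =
  \prod_(q <- s) ((mvar q.1 \mPo spec1 F) - (mvar q.2 \mPo spec1 F)).
Proof.
by rewrite rmorph_prod; apply: eq_bigr => q _; rewrite rmorphB.
Qed.

(** One round of the game: [W] holds the edges that may be colored and [F] those that are; an edge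
    of [W] left uncolored pays with one unit of its exponent. *)
Lemma paint_step s d W : (cpoly s)@_d != 0 ->
  exists F d', [/\ F \subset W,
    (forall q, q \in s -> (q.1 \notin F) || (q.2 \notin F)),
    (forall e, e \notin F -> (d' (enum_rank e) + (e \in W) <= d (enum_rank e))%N) &
    (cpoly (del_pairs F s))@_d' != 0].
Proof.
move=> nz; pose dl e := d (enum_rank e).
(* [cpoly s] is homogeneous, so its only monomial with all exponents at least those of [d] is [d]
   itself. *)
have E : coefsum (enum W) set0 dl (cpoly s) = (cpoly s)@_d.
  have ds : d \in msupp (cpoly s) by rewrite mcoeff_msupp.
  rewrite /coefsum (bigD1_seq d) ?msupp_uniq //= big_seq_cond big1 ?addr0.
    rewrite (_ : expmatch _ _ _ _) // /expmatch.
    by apply/forallP => e; rewrite inE leqnn eqxx if_same.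
  move=> m /andP[ms md]; rewrite (_ : expmatch _ _ _ _ = false) //.
  apply: contraNF md => /forallP H; apply/eqP.
  have le i : (d i <= m i)%N.
    have := H (enum_val i); rewrite inE /dl enum_valK.
    by case: ifP => //= _ /eqP->.
  apply/mnmP => i; apply/esym/(sum_leq_eq le).
  by rewrite -!mdegE !(mdeg_cpoly (s := s)).
rewrite -E in nz.
have [|F [dl' [_ sF H2 H3]]] := coefsum_select (enum_uniq _) _ nz.
  by move=> w _; rewrite inE.
rewrite coefsum_spec1 in H3.
(* Two conflicting edges in [F] would produce the zero factor 1 - 1. *)
have indF q : q \in s -> (q.1 \notin F) || (q.2 \notin F).
  move=> qs; apply: contraNT H3; rewrite negb_or !negbK => /andP[q1 q2].
  by rewrite cpoly_spec1 (big_rem q) //= !mvar_spec1 q1 q2 subrr mul0r mcoeff0.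
(* The factors of pairs meeting [F] are dropped; they take up the part [m2] of the exponent, so [m1]
   can only be smaller. *)
move: H3; rewrite (cpoly_split s (fun q => (q.1 \notin F) && (q.2 \notin F))) rmorphM /=.
case/mcoeffM_neq0 => m1 [m2 [Em H3 _]].
exists F, m1; split=> //.
- by apply/subsetP=> e /sF; rewrite inE mem_enum.
- move=> e eF; have := H2 e eF; rewrite mem_enum /dl.
  apply: leq_trans; rewrite leq_add2r.
  have /mnmP/(_ (enum_rank e)) := Em.
  by rewrite !mnmE enum_rankK (negPf eF) => ->; apply: leq_addr.
move: H3; rewrite cpoly_spec1 /cpoly !big_filter.
congr (_@_ _ != 0); apply: eq_bigr => q /andP[q1 q2].
by rewrite !mvar_spec1 (negPf q1) (negPf q2).
Qed.

End ConflictPolynomial.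

(** * Top coefficients as weighted sums over a grid *)

Section GridSum.
Import GRing.Theory.
Local Open Scope ring_scope.
Variables (R : comNzRingType) (T C : finType) (t w : C -> R) (k0 : nat) (D : R).
Hypothesis moment :
  forall k, (k <= k0)%N -> \sum_c w c * t c ^+ k = if k == k0 then D else 0.

(** Monomial by monomial, the sum is a product of moments. A monomial within the degree bound other
    than the one with all exponents [k0] has an exponent below [k0], hence a vanishing moment. *)
Lemma grid_sum (P : {mpoly R[#|T|]}) :
  (forall m, m \in msupp P -> mdeg m <= #|T| * k0)%N ->
  \sum_(a : {ffun T -> C}) (\prod_e w (a e)) * P.@[fun i => t (a (enum_val i))]
   = D ^+ #|T| * P@_[multinom k0 | i < #|T|].
Proof.
move=> degP; set top := [multinom _ | _ < _].
under eq_bigr do rewrite mevalE mulr_sumr.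
rewrite exchange_big /=.
have term m : \sum_(a : {ffun T -> C}) (\prod_e w (a e)) *
    (P@_m * \prod_i t (a (enum_val i)) ^+ m i) =
    P@_m * \prod_e \sum_c w c * t c ^+ m (enum_rank e).
  rewrite bigA_distr_bigA mulr_sumr; apply: eq_bigr => a _.
  rewrite big_split /= mulrCA; congr (_ * (_ * _)).
  rewrite (reindex enum_rank) /=; last exact: onW_bij (enum_rank_bij _).
  by apply: eq_bigr => e _; rewrite enum_rankK.
under eq_bigr do rewrite term.
have zero m : m \in msupp P -> m != top ->
    \prod_e \sum_c w c * t c ^+ m (enum_rank e) = 0.
  move=> mP mt; suff [e lt] : exists e, (m (enum_rank e) < k0)%N.
    by rewrite (bigD1 e) //= moment ?(ltnW lt) // (ltn_eqF lt) mul0r.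
  apply/existsP; apply: contraNT mt => /existsPn H.
  have ge i : (k0 <= m i)%N by have := H (enum_val i); rewrite enum_valK -leqNgt.
  apply/eqP/mnmP => i; rewrite mnmE; apply/esym/(sum_leq_eq ge).
  by rewrite -mdegE sum_nat_const card_ord; apply: degP.
have topE : \prod_e \sum_c w c * t c ^+ top (enum_rank e) = D ^+ #|T|.
  by under eq_bigr do rewrite mnmE moment // eqxx; rewrite prodr_const.
have [tP|tP] := boolP (top \in msupp P); last first.
  rewrite (memN_msupp_eq0 tP) mulr0 big_seq big1 // => m mP.
  by rewrite zero ?mulr0 //; apply: contraNneq tP => <-.
rewrite (bigD1_seq top) ?msupp_uniq //= topE big_seq_cond big1 ?addr0.
  by rewrite mulrC.
by move=> m /andP[mP mt]; rewrite zero ?mulr0.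
Qed.

End GridSum.

(** * From a nonzero coefficient to a painting strategy *)

Section OnlineStrategy.
Import GRing.Theory.
Local Open Scope ring_scope.
Variables (R : comNzRingType) (T V : finType) (phi : V -> V -> T).
Hypothesis phiC : forall u v, phi u v = phi v u.
Hypothesis phi_inj : forall u v u' v', u != v -> u' != v' ->
  phi u v = phi u' v' -> [set u; v] = [set u'; v'].

(** Here [phi] names the variable of an edge. The budget inequality survives a round: an uncolored
    edge meeting [U] loses at least one unit of [t u + t v], and one disjoint from [U] loses one
    unit of its exponent by [paint_step]. For [m = 0] no edge can satisfy it. *)
Lemma online_of_cpoly m (t : V -> nat) (G : graph V) (s : seq (T * T))
    (d : 'X_{1..#|T|}) :
  (forall u v w, [set u; v] \in edges G -> [set u; w] \in edges G -> v != w ->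
     ((phi u v, phi u w) \in s) || ((phi u w, phi u v) \in s)) ->
  (forall u v, [set u; v] \in edges G ->
     d (enum_rank (phi u v)) + t u + t v < m)%N ->
  (cpoly R s)@_d != 0 -> online_colorable m t G.
Proof.
have edgeP (H : graph V) e : e \in edges H ->
    exists u v, u != v /\ e = [set u; v].
  by move=> eH; have /cards2P[u [v [uv ->]]] := forall_inP (edgesP H) e eH; exists u, v.
have edge_neq (H : graph V) u v : [set u; v] \in edges H -> u != v.
  by move/(forall_inP (edgesP H)); rewrite cards2; case: (u != v).
elim: m t G s d => [|m IH] t G s d conf bud nz /=.
  apply/eqP/setP => e; rewrite inE; apply/negP => eG.
  by have [u [v [_ E]]] := edgeP _ _ eG; have := bud u v; rewrite -E => /(_ eG).
apply/forall_inP => U sU.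
pose W := [set x | [exists u, exists v,
  [&& [set u; v] \in edges G, [disjoint [set u; v] & U] & phi u v == x]]].
have [F [d' [sFW indF bF nz']]] := paint_step W nz.
pose E' := [set e in edges G | [exists u, exists v,
  (e == [set u; v]) && (phi u v \in F)]].
have E'P u v : [set u; v] \in edges G -> ([set u; v] \in E') = (phi u v \in F).
  move=> uvG; rewrite inE uvG /=.
  apply/existsP/idP => [[u' /existsP[v' /andP[/eqP E H]]]|H]; last first.
    by exists u; apply/existsP; exists v; rewrite eqxx.
  have uv := edge_neq _ _ _ uvG.
  have : u' \in [set u; v] by rewrite E set21.
  have : v' \in [set u; v] by rewrite E set22.
  have uv' : u' != v' by apply: (edge_neq G); rewrite -E.
  rewrite !inE => /orP[]/eqP Ev /orP[]/eqP Eu; move: H uv'; rewrite Ev Eu ?eqxx //.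
  by rewrite phiC.
have inW u v : [set u; v] \in edges G ->
    (phi u v \in W) = [disjoint [set u; v] & U].
  move=> uvG; rewrite inE; apply/existsP/idP; last first.
    by move=> H; exists u; apply/existsP; exists v; rewrite uvG H eqxx.
  case=> u' /existsP[v' /and3P[uvG' dis /eqP Ephi]].
  by rewrite (phi_inj (edge_neq _ _ _ uvG) (edge_neq _ _ _ uvG') (esym Ephi)).
apply/existsP; exists E'; apply/and3P; split.
- apply/subsetP => e eE'; have eG : e \in edges G by move: eE'; rewrite inE => /andP[].
  rewrite inE eG /=; have [u [v [_ E]]] := edgeP _ _ eG.
  rewrite E -inW -?E //; apply: (subsetP sFW).
  by rewrite -E'P -?E.
- apply/trivIsetP => e f eE' fE' ef.
  have eG : e \in edges G by move: eE'; rewrite inE => /andP[].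
  have fG : f \in edges G by move: fE'; rewrite inE => /andP[].
  apply: contraR ef => /pred0Pn[u /andP[/= ue uf]]; apply/eqP.
  have rep g : g \in edges G -> u \in g -> exists v, g = [set u; v].
    move=> gG; have [x [y [_ ->]]] := edgeP _ _ gG.
    rewrite !inE => /orP[]/eqP->; first by exists y.
    by exists x; rewrite setUC.
  have [v Ev] := rep e eG ue; have [w Ew] := rep f fG uf; subst e f.
  have [->//|vw] := eqVneq v w.
  move: eE' fE'; rewrite !E'P // => vF wF.
  by case/orP: (conf _ _ _ eG fG vw) => /indF /=; rewrite vF wF.
apply: (IH _ _ _ _ _ _ nz') => [u v w|u v].
  rewrite !in_setD => /andP[vE vG] /andP[wE wG] vw.
  have vF : phi u v \notin F by rewrite -E'P.
  have wF : phi u w \notin F by rewrite -E'P.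
  by rewrite !mem_filter /= vF wF; apply: conf.
rewrite in_setD => /andP[vE vG].
have vF : phi u v \notin F by rewrite -E'P.
have := bud u v vG; have := bF _ vF; rewrite inW // /subind.
(* On [U] the function [t] is positive, so [subind] really decreases it. *)
have tU x : x \in U -> (0 < t x)%N.
  by move/(subsetP sU); rewrite inE lt0n.
have [dis|] := boolP [disjoint _ & _]; first by lia.
move=> /pred0Pn[x /andP[/= xuv xU]] b1 b2.
have tx := tU x xU; move: xuv tx xU.
by rewrite !inE => /orP[]/eqP-> tx xU; move: tx; rewrite xU; lia.
Qed.

End OnlineStrategy.

(** * The adversary *)

Section Adversary.
Variable V : finType.
Implicit Types (G : graph V) (t : V -> nat) (v : V).

Definition deg G v : nat := #|[set e in edges G | v \in e]|.

Lemma deg_dele_trivIset G v (F : {set {set V}}) : trivIset F ->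
  deg G v <= (deg (dele G F) v).+1.
Proof.
move=> tF; rewrite /deg.
have [F0|[f]] := set_0Vmem [set e in F | v \in e]; last first.
  rewrite inE => /andP[fF vf].
  apply: (@leq_trans #|f |: [set e in edges (dele G F) | v \in e]|); last first.
    by rewrite cardsU1; lia.
  apply/subset_leq_card/subsetP => e; rewrite !inE => /andP[eG ve].
  rewrite eG ve !andbT; case: eqVneq => [//|ef] /=.
  apply: contraNN ef => eF; apply: contraTT vf => ef.
  by rewrite (disjointFr (trivIsetP tF _ _ eF fF ef) ve).
apply/leqW/subset_leq_card/subsetP => e; rewrite !inE => /andP[eG ve].
rewrite eG ve !andbT; apply/negP => eF.
by have /setP/(_ e) := F0; rewrite !inE eF ve.
Qed.

Lemma deg_dele_disjoint G v (F : {set {set V}}) :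
  (forall e, e \in F -> v \notin e) -> deg (dele G F) v = deg G v.
Proof.
move=> vF; apply: eq_card => e; rewrite !inE.
by case: (boolP (e \in F)) => [/vF/negPf->|_ //]; rewrite !andbF.
Qed.

(* The adversary first spends the avoidances of [v] alone, then those of all
   other vertices together; none of these rounds colors an edge at [v]. *)
Lemma online_colorable_deg m t G v k1 k2 : online_colorable m t G ->
  0 < deg G v -> k1 <= t v -> (forall u, u != v -> k2 <= t u) ->
  deg G v + k1 + k2 <= m.
Proof.
elim: m t G k1 k2 => [|m IH] t G k1 k2 /=.
  move=> /eqP G0 /card_gt0P[e]; by rewrite G0 !inE.
move=> /forall_inP col dpos le1 le2.
have [k1_0|k1pos] := posnP k1; last first.
  have [|F /and3P[/subsetP sF _ colF]] := existsP (col [set v] _).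
    by rewrite sub1set inE; lia.
  have dF : deg (dele G F) v = deg G v.
    apply: deg_dele_disjoint => e /sF; rewrite inE => /andP[_].
    by rewrite disjoint_sym disjoints1.
  have := IH _ _ k1.-1 k2 colF; rewrite dF /subind set11 => /(_ dpos).
  case: k1 k1pos le1 => // k1 _ le1 H.
  have : deg G v + k1 + k2 <= m; last by lia.
  apply: H => [|u uv]; first by rewrite /=; lia.
  by rewrite inE (negPf uv) subn0 le2.
have [k2_0|k2pos] := posnP k2; last first.
  have [|F /and3P[/subsetP sF _ colF]] := existsP (col [set~ v] _).
    by apply/subsetP => u; rewrite !inE => /le2; lia.
  (* Every edge has an end other than [v], so nothing can be colored in this round. *)
  have eF e : e \notin F.
    apply/negP => /sF; rewrite inE => /andP[eG].
    rewrite disjoints_subset setCK => /subset_leq_card.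
    by rewrite cards1 (eqP (forall_inP (edgesP G) _ eG)).
  have dF : deg (dele G F) v = deg G v.
    by apply: deg_dele_disjoint => e; rewrite (negPf (eF e)).
  have := IH _ _ k1 k2.-1 colF; rewrite dF /subind => /(_ dpos).
  rewrite !inE eqxx subn0 => /(_ le1) H.
  have : deg G v + k1 + k2.-1 <= m; last by lia.
  by apply: H => u uv; rewrite !inE uv; have := le2 u uv; lia.
have [|F /and3P[_ tF colF]] := existsP (col set0 _); first exact: sub0set.
have := deg_dele_trivIset G v tF; have := IH _ _ 0 0 colF.
by case: (deg _ v) => [_|d /(_ isT isT (fun _ _ => isT))]; lia.
Qed.

End Adversary.

Lemma deg_complete n (v : 'I_n) : deg (complete n) v = n - 1.
Proof.
rewrite /deg /=.
have -> : [set e in [set e : {set 'I_n} | #|e| == 2] | v \in e]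
    = [set [set v; u] | u in [set~ v]].
  apply/setP => e; rewrite !inE; apply/andP/imsetP.
    case=> /cards2P[x [y [xy ->]]]; rewrite !inE => /orP[]/eqP->.
      by exists y; rewrite // !inE eq_sym.
    by exists x; rewrite 1?setUC // !inE.
  by case=> u; rewrite !inE => uv ->; rewrite set21 cards2 (eq_sym v) uv.
rewrite card_in_imset => [|u u']; first by rewrite cardsC1 card_ord subn1.
rewrite !inE => uv u'v /setP/(_ u); rewrite !inE eqxx orbT (negPf uv) /=.
by move/esym/eqP.
Qed.

Lemma online_complete_lower m n t : 2 <= n ->
  online_colorable m (fun=> t) (complete n) ->
  (if odd n then n + 2 * t else n + 2 * t - 1) <= m.
Proof.
move=> n2 col; case: ifP => on; last first.
  pose v : 'I_n := Ordinal (ltnW n2).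
  have := online_colorable_deg (v := v) (k1 := t) (k2 := t) col.
  by rewrite deg_complete subn_gt0 => /(_ n2 (leqnn t) (fun _ _ => leqnn t)); lia.
case: m col => [/= G0|m /forall_inP col].
  have := deg_complete (Ordinal (ltnW n2)); rewrite /deg /= (eqP G0).
  rewrite (_ : [set _ in _ | _] = set0) ?cards0; first by lia.
  by apply/setP => e; rewrite !inE.
have [|F /and3P[sF tF colF]] := existsP (col set0 _); first exact: sub0set.
have F2 e : e \in F -> #|e| = 2.
  by move/(subsetP sF); rewrite !inE => /andP[/eqP].
(* An independent set of edges covers an even number of vertices. *)
have /existsP[v vF] : [exists v, v \notin cover F].
  apply: contraTT on => /existsPn H.
  have F1 : cover F = [set: 'I_n].
    by apply/setP => v; have := H v; rewrite negbK inE.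
  have : \sum_(A in F) #|A| = #|cover F| by apply/eqP.
  rewrite F1 cardsT card_ord (eq_bigr (fun=> 2)) // sum_nat_const => <-.
  by rewrite muln2 odd_double.
have dF : deg (dele (complete n) F) v = n - 1.
  rewrite deg_dele_disjoint ?deg_complete // => e eF.
  by apply: contraNN vF => ve; apply/bigcupP; exists e.
have := online_colorable_deg (v := v) (k1 := t) (k2 := t) colF.
by rewrite dF /subind => H; have : n - 1 + t + t <= m; [apply: H => *; rewrite ?inE; lia | lia].
Qed.

(** * Coefficients as signed sums over symmetric Latin squares *)

(** The cells of a symmetric square, diagonal included; off the diagonal, a cell is an edge of the
    complete graph. *)
Notation upair n := {q : 'I_n * 'I_n | q.1 <= q.2}.

Section UnorderedPairs.
Variable n : nat.
Implicit Types i j k l : 'I_n.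

Definition osort i j := if i <= j then (i, j) else (j, i).

Lemma osortP i j : (osort i j).1 <= (osort i j).2.
Proof. by rewrite /osort; case: (leqP i j) => [|/ltnW]. Qed.

Definition up i j : upair n := exist _ (osort i j) (osortP i j).

Lemma upC i j : up i j = up j i.
Proof.
apply: val_inj; rewrite /= /osort; case: ltngtP => // E.
by congr (_, _); apply: val_inj.
Qed.

Lemma up_val (e : upair n) : up (val e).1 (val e).2 = e.
Proof.
by apply: val_inj; case: e => [[i j] /= le]; rewrite /osort le.
Qed.

Lemma up_inj i j k l : up i j = up k l -> (i = k /\ j = l) \/ (i = l /\ j = k).
Proof.
move/(congr1 val); rewrite /= /osort.
by case: ifP; case: ifP => _ _ [-> ->]; auto.
Qed.

Lemma big_upair (R : Type) (idx : R) (op : Monoid.com_law idx) (F : upair n -> R) :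
  \big[op/idx]_e F e = \big[op/idx]_(q : 'I_n * 'I_n | q.1 <= q.2) F (up q.1 q.2).
Proof.
rewrite [RHS](reindex_onto (val : upair n -> _) (fun q => up q.1 q.2)) /=.
  apply: eq_big => [e|e _]; last by rewrite up_val.
  by rewrite up_val eqxx (valP e).
by case=> i j le; rewrite /= /osort le.
Qed.

Definition ltpair := [pred q : 'I_n * 'I_n | q.1 < q.2].

Lemma big_pair_sym (R : Type) (idx : R) (op : Monoid.com_law idx)
    (F : 'I_n -> 'I_n -> R) : (forall i j, F i j = F j i) ->
  \big[op/idx]_i \big[op/idx]_j F i j =
  op (op (\big[op/idx]_(q in ltpair) F q.1 q.2) (\big[op/idx]_(q in ltpair) F q.1 q.2))
     (\big[op/idx]_i F i i).
Proof.
move=> FC; rewrite pair_bigA /= (bigID ltpair) /= -Monoid.mulmA; congr (op _ _).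
rewrite (bigID [pred q : 'I_n * 'I_n | q.1 == q.2]) /= Monoid.mulmC; congr (op _ _).
  rewrite (reindex_inj (h := fun q : 'I_n * 'I_n => (q.2, q.1))) /=; last first.
    by case=> i j [k l] [-> ->].
  apply: eq_big => [[i j]|[i j] _]; last by rewrite FC.
  by rewrite inE /= -leqNgt ltn_neqAle eq_sym andbC.
rewrite (reindex_onto (fun i => (i, i)) fst) /=; last first.
  by case=> i j /= /andP[_ /eqP->].
by apply: eq_bigl => i; rewrite ltnn !eqxx.
Qed.

Lemma big_upair_diag (R : Type) (idx : R) (op : Monoid.com_law idx)
    (F : upair n -> R) :
  \big[op/idx]_e F e =
  op (\big[op/idx]_(q in ltpair) F (up q.1 q.2)) (\big[op/idx]_i F (up i i)).
Proof.
rewrite big_upair (bigID ltpair) /=; congr (op _ _).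
  by apply: eq_bigl => -[i j] /=; rewrite inE /= andb_idl // => /ltnW.
rewrite (reindex_onto (fun i => (i, i)) fst) /=; last first.
  case=> i j /= /andP[le]; rewrite -leqNgt => ge; congr (_, _).
  by apply/val_inj/eqP; rewrite eqn_leq le.
by apply: eq_bigl => i; rewrite ltnn leqnn !eqxx.
Qed.

Lemma card_ltpair : #|ltpair| + #|ltpair| + n = n * n.
Proof.
have := big_pair_sym addn (F := fun _ _ => 1) (fun _ _ => erefl).
by rewrite /= !sum_nat_const !card_ord !muln1 => <-.
Qed.

Lemma card_upair : #|{: upair n}| = #|ltpair| + n.
Proof.
have := big_upair_diag addn (fun _ => 1).
by rewrite !sum_nat_const !card_ord !muln1.
Qed.

End UnorderedPairs.

Section VandermondeRows.
Import GRing.Theory.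
Local Open Scope ring_scope.

Definition vdm (R : comNzRingType) n (t : 'I_n -> R) : R :=
  \det (Vandermonde n (\row_j t j)).

Lemma vdmE (R : comNzRingType) n (t : 'I_n -> R) :
  vdm t = \prod_(q in ltpair n) (t q.2 - t q.1).
Proof.
rewrite /vdm det_Vandermonde pair_big_dep /=.
by apply: eq_big => [[i j]|[i j] _] //=; rewrite !mxE.
Qed.

Lemma vdm_neq0 (R : idomainType) n (t : 'I_n -> R) : injective t -> vdm t != 0.
Proof.
move=> natr_ord_inj; rewrite vdmE; apply/prodf_neq0 => -[i j] /=; rewrite inE /= => lt.
by rewrite subr_eq0 (inj_eq natr_ord_inj) -val_eqE /= gtn_eqF.
Qed.

(* The sign of [f] if [f] is a permutation, and 0 otherwise. *)
Definition sgf n (f : 'I_n -> 'I_n) : int := \det (\matrix_(i, j) (f i == j)%:R).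

Lemma eq_sgf n (f g : 'I_n -> 'I_n) : f =1 g -> sgf f = sgf g.
Proof. by move=> E; congr (\det _); apply/matrixP => i j; rewrite !mxE E. Qed.

Lemma sgf_comp n (f g : 'I_n -> 'I_n) : sgf (g \o f) = sgf f * sgf g.
Proof.
rewrite /sgf -det_mulmx; congr (\det _); apply/matrixP => i j; rewrite !mxE.
rewrite (bigD1 (f i)) //= !mxE eqxx mul1r big1 ?addr0 // => k ne.
by rewrite !mxE eq_sym (negPf ne) mul0r.
Qed.

Lemma sgf_id n : sgf (fun i : 'I_n => i) = 1.
Proof.
rewrite -[RHS](det1 _ n); congr (\det _); apply/matrixP => i j; rewrite !mxE //.
Qed.

Lemma sgf_neq0 n (f : 'I_n -> 'I_n) : (sgf f != 0) = injectiveb f.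
Proof.
apply/idP/injectiveP => [nz i j E|fI].
  apply/eqP; apply: contraNT nz => ij; apply/eqP.
  by apply: (determinant_alternate ij) => k; rewrite !mxE E.
have [g fK gK] := injF_bij fI.
have : sgf f * sgf g = 1 by rewrite -sgf_comp -[RHS](sgf_id n); apply: eq_sgf.
by apply: contra_eq_neq => ->; rewrite mul0r eq_sym oner_neq0.
Qed.

Lemma sgf_sqr n (f : 'I_n -> 'I_n) : injective f -> sgf f * sgf f = 1.
Proof.
move=> fI; have [g fK gK] := injF_bij fI.
have E : sgf f * sgf g = 1 by rewrite -sgf_comp -[RHS](sgf_id n); apply: eq_sgf.
have : sgf f \is a GRing.unit by apply/unitrPr; exists (sgf g).
by rewrite qualifE /= => /orP[]/eqP->.
Qed.

(** The Vandermonde matrix of [t \o f] is that of [t] times the transposed 0/1 matrix of [f],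
    whether or not [f] is a permutation. *)
Lemma vdm_sgf (R : comNzRingType) n (t : 'I_n -> R) (f : 'I_n -> 'I_n) :
  vdm (t \o f) = vdm t * (sgf f)%:~R.
Proof.
rewrite /sgf /vdm -(det_map_mx intr) -[X in _ * X]det_tr -det_mulmx.
congr (\det _); apply/matrixP => r i; rewrite !mxE (bigD1 (f i)) //=.
rewrite !mxE eqxx mulr1 big1 ?addr0 // => j ne.
by rewrite !mxE eq_sym (negPf ne) mulr0.
Qed.

End VandermondeRows.

(** * Interpolation over symmetric Latin squares *)

Section LatinSum.
Import GRing.Theory.
Local Open Scope ring_scope.
Variables (R : idomainType) (n' : nat).
Notation n := n'.+1.
Notation T := (upair n).
Implicit Types (a : {ffun T -> 'I_n}) (M : {mpoly R[#|{: T}|]}).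

(** Cells of a common row stand for edges with a common end. The larger column comes first, as in
    the differences of [vdmE]. *)
Definition row_pairs : seq (T * T) :=
  [seq (up x.1 x.2.2, up x.1 x.2.1) |
    x <- enum [pred x : 'I_n * ('I_n * 'I_n) | x.2 \in ltpair n]].

Definition diag_pairs : seq (T * T) :=
  [seq (up q.2 q.2, up q.1 q.1) | q <- enum (ltpair n)].

Lemma size_row_pairs : size row_pairs = (n * #|ltpair n|)%N.
Proof.
rewrite size_map -cardE -[X in (X * _)%N]card_ord -cardX.
by apply: eq_card => -[i q]; rewrite !inE.
Qed.

Lemma size_diag_pairs : size diag_pairs = #|ltpair n|.
Proof. by rewrite size_map -cardE. Qed.

Variable t : 'I_n -> R.
Hypothesis t_inj : injective t.
Notation ev a := (fun i => t (a (enum_val i))).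

Lemma meval_mvar a (e : T) : (mvar R e).@[ev a] = t (a e).
Proof. by rewrite mevalXU enum_rankK. Qed.

Lemma meval_row_pairs a :
  (cpoly R row_pairs).@[ev a] = \prod_r (vdm t * (sgf (fun j => a (up r j)))%:~R).
Proof.
rewrite rmorph_prod big_map big_enum /=.
under [RHS]eq_bigr do rewrite -vdm_sgf vdmE.
rewrite pair_big /=; apply: eq_big => [[r q]|[r q] _]; first by rewrite inE.
by rewrite mevalB !meval_mvar.
Qed.

Lemma meval_diag_pairs a :
  (cpoly R diag_pairs).@[ev a] = vdm t * (sgf (fun j => a (up j j)))%:~R.
Proof.
rewrite -vdm_sgf vdmE rmorph_prod big_map big_enum /=.
by apply: eq_bigr => q _; rewrite mevalB !meval_mvar.
Qed.

Definition topmn : 'X_{1..#|{: T}|} := [multinom n' | _ < #|{: T}|].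

(** A symbol occurs an even number of times off the diagonal and [n] times in all, hence at least
    once on the diagonal; the diagonal has only [n] cells, so exactly once. *)
Lemma card_color a c : odd n -> (forall r, injective (fun j => a (up r j))) ->
  (#|[pred e | a e == c]| = (n')./2.+1)%N.
Proof.
move=> on rI.
have rows c' r : (\sum_j (a (up r j) == c') = 1)%N.
  have [g _ gK] := injF_bij (rI r).
  rewrite (bigD1 (g c')) //= gK eqxx big1 // => j ne.
  by case: eqP => // E; case/eqP: ne; apply: (rI r); rewrite gK.
pose off c' := (\sum_(q in ltpair n) (a (up q.1 q.2) == c'))%N.
pose dia c' := (\sum_i (a (up i i) == c'))%N.
have offdia c' : (n = off c' + off c' + dia c')%N.
  rewrite -(@big_pair_sym _ _ _ addn (fun i j => nat_of_bool (a (up i j) == c'))).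
    by rewrite (eq_bigr (fun=> 1%N)) // sum_nat_const card_ord muln1.
  by move=> i j; rewrite upC.
have dia1 c' : (1 <= dia c')%N by have := offdia c'; have := on; lia.
have diaE : 1%N = dia c.
  apply: (sum_leq_eq dia1); rewrite exchange_big /= leq_sum // => i _.
  by rewrite (bigD1 (a (up i i))) //= eqxx big1 // => k; rewrite eq_sym => /negPf->.
rewrite -sum1_card big_mkcond /= (eq_bigr (fun e => nat_of_bool (a e == c))); last first.
  by move=> e _; rewrite inE; case: eqP.
rewrite (big_upair_diag addn) /= -/(off c) -/(dia c).
by have := offdia c; rewrite -diaE; lia.
Qed.

(** A filling of the cells contributes the product of the Vandermonde determinants of its rows, so
    only Latin squares survive, and by [card_color] the product of the interpolation weights is the
    same for all of them. *)
Lemma latin_coef M : odd n -> (forall m, m \in msupp M -> mdeg m <= #|ltpair n|)%N ->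
  \sum_(a : {ffun T -> 'I_n}) (\prod_r sgf (fun j => a (up r j)))%:~R * M.@[ev a] != 0 ->
  (cpoly R row_pairs * M)@_topmn != 0.
Proof.
move=> on degM nz.
pose V := Vandermonde n (\row_j t j).
(* Expansion of the determinant with row [k] in place of the last row gives 0 unless [k = n']. *)
pose w c := cofactor V ord_max c.
have moment k : (k <= n')%N ->
    \sum_c w c * t c ^+ k = if k == n' then vdm t else 0.
  move=> kn; have kn' : (k < n)%N by [].
  have := congr1 (fun A : 'M_n => A (Ordinal kn') ord_max) (mul_mx_adj V).
  rewrite !mxE -val_eqE /= mulrb => <-; apply: eq_bigr => c _.
  by rewrite !mxE mulrC.
have w_neq0 c : w c != 0.
  rewrite /w /cofactor mulf_neq0 ?signr_eq0 //.
  rewrite (_ : row' ord_max (col' c V) =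
    (Vandermonde n' (\row_(j < n') t (lift c j)) : 'M_n.-1)); last first.
    by apply/matrixP => i j; rewrite !mxE /= /bump leqNgt ltn_ord.
  by apply: vdm_neq0 => i j /t_inj /lift_inj.
(* With n(n+1)/2 cells, the admissible degree exceeds that of the row factors by exactly n(n-1)/2,
   the room left for [M]. *)
have degPM m : m \in msupp (cpoly R row_pairs * M) -> (mdeg m <= #|{: T}| * n')%N.
  move=> /msuppM_le /allpairsP [[m1 m2] /= [m1P m2P ->]].
  rewrite mdegD (mdeg_cpoly m1P) size_row_pairs.
  apply: (@leq_trans (n * #|ltpair n| + #|ltpair n|)); first by rewrite leq_add2l degM.
  by rewrite card_upair; have := card_ltpair n; nia.
have := grid_sum moment degPM; rewrite -/topmn.
have -> : \sum_(a : {ffun T -> 'I_n}) (\prod_e w (a e)) * (cpoly R row_pairs * M).@[ev a] =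
    ((\prod_c w c) ^+ (n')./2.+1 * vdm t ^+ n) *
    \sum_(a : {ffun T -> 'I_n}) (\prod_r sgf (fun j => a (up r j)))%:~R * M.@[ev a].
  rewrite mulr_sumr; apply: eq_bigr => a _.
  rewrite mevalM meval_row_pairs [X in _ * (X * _)]big_split /= prodr_const card_ord.
  rewrite -(rmorph_prod intr).
  have [/forallP rI|/forallPn[r rN]] := boolP [forall r, injectiveb (fun j => a (up r j))].
    rewrite (_ : \prod_e w (a e) = (\prod_c w c) ^+ (n')./2.+1); first by ring.
    rewrite (partition_big (fun e => a e) predT) //= -prodrXl.
    apply: eq_bigr => c _; rewrite (eq_bigr (fun=> w c)) => [|e /eqP-> //].
    by rewrite prodr_const card_color // => r; apply/injectiveP.
  rewrite (bigD1 r) //=.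
  have /eqP-> : sgf (fun j => a (up r j)) == 0.
    by apply: contraNT rN; rewrite sgf_neq0.
  by rewrite !(mul0r, mulr0).
move=> E; have : (vdm t) ^+ #|{: T}| * (cpoly R row_pairs * M)@_topmn != 0.
  rewrite -E !mulf_neq0 ?expf_neq0 ?vdm_neq0 //.
  by apply/prodf_neq0 => c _.
by apply: contraNneq => ->; rewrite mulr0.
Qed.

End LatinSum.

(** * Complete graphs of odd order *)

Section PrefixSum.
Variables (n : nat) (f : 'I_n -> 'I_n) (l : nat).
Hypotheses (f_inj : injective f) (ln : l <= n).

Let card_prefix : #|[pred j : 'I_n | j < l]| = l.
Proof.
rewrite -sum1_card (eq_bigl (fun j : 'I_n => j < l)) //.
by rewrite (big_ord_narrow ln) sum1_card card_ord.
Qed.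

(** The rank of [f j] among the first [l] values; it is at most [f j], and the ranks of the first
    [l] positions add up to l(l-1)/2. *)
Let below (j : 'I_n) : nat := \sum_(k : 'I_n | k < l) (f k < f j).

Let below_leq j : below j <= f j.
Proof.
rewrite /below -big_mkcondr sum1_card -(card_imset _ f_inj).
rewrite -[X in _ <= X](card_ord (f j)).
pose h (x : 'I_(f j)) : 'I_n := widen_ord (ltnW (ltn_ord (f j))) x.
rewrite -[X in _ <= X](card_imset predT (f := h)); last first.
  by move=> x y /(congr1 val) /= E; apply: val_inj.
apply/subset_leq_card/subsetP => x /imsetP[k /andP[_ lt] ->].
by apply/imsetP; exists (Ordinal lt); last apply: val_inj.
Qed.

Let below_lt (j : 'I_n) : j < l -> below j < l.
Proof.
move=> jl; rewrite /below -big_mkcondr sum1_card -[X in _ < X]card_prefix.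
apply/proper_card/properP; split; first by apply/subsetP => k /andP[].
by exists j => //; rewrite unfold_in /= ltnn andbF.
Qed.

Let sum_below : (\sum_(j : 'I_n | j < l) below j).*2 + l = l * l.
Proof.
have E1 : \sum_(j : 'I_n | j < l) below j =
    \sum_(j : 'I_n | j < l) \sum_(k : 'I_n | k < l) (f j < f k).
  by rewrite /below exchange_big.
have E2 : l = \sum_(j : 'I_n | j < l) \sum_(k : 'I_n | k < l) (k == j).
  rewrite -[LHS]card_prefix -sum1_card; apply: eq_bigr => j jl.
  by rewrite (bigD1 j) //= eqxx big1 // => k /andP[_ /negPf->].
rewrite -addnn {2}E1 [X in _ + X]E2 -!big_split /=.
have -> : l * l = \sum_(j : 'I_n | j < l) \sum_(k : 'I_n | k < l) 1.
  rewrite -{1 2}card_prefix -sum_nat_const; apply: eq_bigr => j _.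
  by rewrite sum1_card.
apply: eq_bigr => j _; rewrite /below -!big_split /=; apply: eq_bigr => k _.
rewrite -(inj_eq f_inj) -val_eqE /=.
by case: ltngtP.
Qed.

Lemma prefix_sum_geq : l * l <= (\sum_(j : 'I_n | j < l) f j).*2 + l.
Proof.
rewrite -sum_below leq_add2r leq_double.
by apply: leq_sum => j _; apply: below_leq.
Qed.

(** Equality forces each of the first [l] values to equal its rank, hence to be below [l]; by
    injectivity these values fill all places below [l]. *)
Lemma prefix_sum_eq : (\sum_(j : 'I_n | j < l) f j).*2 + l <= l * l ->
  forall j : 'I_n, (f j < l) = (j < l).
Proof.
rewrite -sum_below leq_add2r leq_double => le.
have lt (j : 'I_n) : j < l -> f j < l.
  move=> jl; have := below_lt jl; congr (_ < _).
  pose F (b : 'I_n -> nat) (j : 'I_n) := if j < l then b j else 0.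
  have /(_ j) : F below =1 F (fun j => f j : nat).
    apply: sum_leq_eq => [k|]; last by rewrite -!big_mkcond.
    by rewrite /F; case: ifP => // _; apply: below_leq.
  by rewrite /F jl.
pose A := [set j : 'I_n | j < l].
have fA : f @: A = A.
  apply/eqP; rewrite eqEcard card_imset // leqnn andbT.
  by apply/subsetP => _ /imsetP[j + ->]; rewrite !inE => /lt.
by move=> j; have := mem_imset A j f_inj; rewrite fA !inE.
Qed.

End PrefixSum.

(** Induction over the lower rows first and from left to right. A value below the claimed one
    already occurs further down in column [j], a larger one already occurs further left in row
    [i]. *)
Lemma staircase (a : nat -> nat -> nat) L :
  (forall i j k, i + j < L -> i + k < L -> a i j = a i k -> j = k) ->
  (forall i i' j, i + j < L -> i' + j < L -> a i j = a i' j -> i = i') ->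
  (forall i j, i + j < L -> a i j + i < L) ->
  forall i j, i + j < L -> a i j = L.-1 - (i + j).
Proof.
move=> rowI colI bnd i j ij.
have [N] := ubnP (L - i + j); elim: N => // N IH in i j ij *; rewrite ltnS => le.
have b := bnd i j ij; have [lt|gt|//] := ltngtP (a i j) (L.-1 - (i + j)).
  pose i' := L.-1 - a i j - j.
  have E : a i' j = a i j by rewrite IH /i'; lia.
  by have := colI i' i j; rewrite E /i'; lia.
pose j' := L.-1 - a i j - i.
have E : a i j' = a i j by rewrite IH /j'; lia.
by have := rowI i j' j; rewrite E /j'; lia.
Qed.

(** * Symmetric Latin squares of least weight *)

Section OddComplete.
Import GRing.Theory.
Local Open Scope ring_scope.
Variable n' : nat.
Notation n := n'.+1.
Notation T := (upair n).
Implicit Types a : {ffun T -> 'I_n}.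

(** Ordered pairs are listed, so an off-diagonal cell occurs twice; the length is thus the degree
    that [latin_coef] allows for [M]. *)
Definition triangle : seq T :=
  [seq up q.1 q.2 | q <- enum [pred q : 'I_n * 'I_n | q.1 + q.2 < n']%N].

Lemma size_triangle : size triangle = #|ltpair n|.
Proof.
rewrite size_map -cardE -!sum1_card.
rewrite [RHS](reindex_inj (h := fun q : 'I_n * 'I_n => (q.1, rev_ord q.2))) /=.
  apply: eq_bigl => -[i j]; rewrite !inE /=.
  by have := ltn_ord i; have := ltn_ord j; lia.
move=> [i j] [k l] E; congr (_, _); first by case: E.
by apply: rev_ord_inj; case: E => _ E; apply: val_inj.
Qed.

Definition weight a : nat := (\sum_(i < n) \sum_(j < n | j < n' - i) a (up i j))%N.

Lemma weightE a : weight a = (\sum_(x <- triangle) a x)%N.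
Proof.
rewrite /weight big_map big_enum pair_big_dep /=.
by apply: eq_bigl => -[i j]; rewrite inE /= ltn_subRL.
Qed.

(** The entry at (i, j) is n' - 1 - (i + j) modulo n, so row i begins with n' - 1 - i, ..., 1, 0 and
    meets the bound of [prefix_sum_geq] with equality. *)
Definition anticyclic : {ffun T -> 'I_n} :=
  [ffun e : T => let k := ((val e).1 + (val e).2)%N in
     inord (if k < n' then n'.-1 - k else n' + n' - k)%N].

Lemma anticyclicE i j : anticyclic (up i j) =
  (if i + j < n' then n'.-1 - (i + j) else n' + n' - (i + j))%N :> nat.
Proof.
rewrite ffunE /=.
have -> : ((osort i j).1 + (osort i j).2 = i + j)%N.
  by rewrite /osort; case: ifP => //= _; apply: addnC.
by rewrite inordK //; have := ltn_ord i; have := ltn_ord j; case: ifP; lia.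
Qed.

Lemma anticyclic_inj r : injective (fun j => anticyclic (up r j)).
Proof.
move=> j k /(congr1 val) /=; rewrite !anticyclicE => E; apply: val_inj => /=.
move: E; have := ltn_ord r; have := ltn_ord j; have := ltn_ord k.
by do 2!case: ifP; lia.
Qed.

Lemma weight_anticyclic :
  ((weight anticyclic).*2 + \sum_(i < n) (n' - i) = \sum_(i < n) (n' - i) * (n' - i))%N.
Proof.
have down l : ((\sum_(0 <= j < l) (l.-1 - j)).*2 + l = l * l)%N.
  elim: l => [|l IH]; first by rewrite big_nil.
  rewrite big_nat_recl //= (eq_bigr (fun j => l.-1 - j)%N) => [|j _]; last by lia.
  by rewrite doubleD; move: IH; nia.
rewrite /weight -muln2 big_distrl -big_split /=; apply: eq_bigr => i _.
rewrite -[RHS]down muln2; congr (_.*2 + _)%N.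
rewrite [RHS]big_mkord.
rewrite (big_ord_narrow (_ : n' - i <= n)%N); first by lia.
move=> le; apply: eq_bigr => j _; rewrite anticyclicE /=.
by have := ltn_ord j; case: ifP; lia.
Qed.

(** All prefix bounds are equalities, so the first n' - i entries of row i are exactly the values
    below n' - i. Then [staircase] determines the part above the antidiagonal. *)
Lemma weight_min_uniq a : (forall r, injective (fun j => a (up r j))) ->
  weight a = weight anticyclic -> a = anticyclic.
Proof.
move=> rI aw.
have pre (i j : 'I_n) : (a (up i j) < n' - i)%N = (j < n' - i)%N.
  apply: (prefix_sum_eq (l := n' - i) (rI i)); first by lia.
  pose S (i : 'I_n) := (\sum_(j < n | j < n' - i) a (up i j))%N.
  pose F (i : 'I_n) := ((n' - i) * (n' - i))%N.
  have /(_ i) /= <- // : F =1 (fun i : 'I_n => (S i).*2 + (n' - i))%N.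
  apply: sum_leq_eq => [k|]; first by apply: prefix_sum_geq => //; lia.
  rewrite /F -weight_anticyclic -aw /weight big_split /= -/(S _) leq_add2r.
  by rewrite -muln2 big_distrl; apply: leq_sum => k _; rewrite /= muln2.
pose b i j := val (a (up (inord i) (inord j))).
have inK i : (i < n)%N -> val (inord i : 'I_n) = i by exact: inordK.
have b_inj i j k : (j < n)%N -> (k < n)%N -> b i j = b i k -> j = k.
  by move=> jn kn /val_inj /rI /(congr1 val); rewrite !inK.
have bC i j : b i j = b j i by rewrite /b upC.
have b_pre i j : (i < n)%N -> (j < n)%N -> (b i j < n' - i)%N = (j < n' - i)%N.
  by move=> i_n jn; have := pre (inord i) (inord j); rewrite !inK.
have b_n i j : (b i j < n)%N by exact: ltn_ord.
have low i j : (i + j < n')%N -> b i j = (n'.-1 - (i + j))%N.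
  apply: staircase => {i j} [i j k|i i' j|i j] H; last first.
  - by have := b_pre i j; lia.
  - by rewrite !(bC _ j) => H' /b_inj; apply; lia.
  - by move=> H' /b_inj; apply; lia.
(* On and below the antidiagonal, [staircase] applies to the square rotated by a half turn with
   complemented entries. *)
have high i j : (i + j < n)%N -> (n' - b (n' - i) (n' - j) = n' - (i + j))%N.
  apply: (staircase (a := fun i j => n' - b (n' - i) (n' - j))%N) => {i j} [i j k|i i' j|i j] H.
  - move=> H' E; have : (n' - j = n' - k)%N; last by lia.
    apply: (b_inj (n' - i)%N); try lia.
    by have := b_n (n' - i)%N (n' - j)%N; have := b_n (n' - i)%N (n' - k)%N; lia.
  - move=> H' E; have : (n' - i = n' - i')%N; last by lia.
    apply: (b_inj (n' - j)%N); try lia; rewrite !(bC (n' - j)%N).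
    by have := b_n (n' - i)%N (n' - j)%N; have := b_n (n' - i')%N (n' - j)%N; lia.
  - by have := b_pre (n' - i)%N (n' - j)%N; lia.
apply/ffunP => e; rewrite -(up_val e); move: (val e) => [i j] /=.
apply: val_inj; rewrite /= anticyclicE.
have -> : val (a (up i j)) = b i j by rewrite /b !inord_val.
have := ltn_ord i; have := ltn_ord j.
case: ifP => [/low //|ge] jn i_n.
have := high (n' - i)%N (n' - j)%N; have := b_n i j.
rewrite !subKn //; lia.
Qed.

Lemma row_pairs_conflict (r j k : 'I_n) : j != k ->
  ((up r j, up r k) \in row_pairs n') || ((up r k, up r j) \in row_pairs n').
Proof.
have mem (x y : 'I_n) : (x < y)%N -> (up r y, up r x) \in row_pairs n'.
  by move=> xy; apply/mapP; exists (r, (x, y)); rewrite ?mem_enum ?inE.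
by case: (ltngtP j k) => [/mem->|/mem->|/val_inj->]; rewrite ?orbT ?eqxx.
Qed.

Lemma mdeg_prod_mvar (R : comNzRingType) (I : finType) (s : seq I) m :
  m \in msupp (\prod_(e <- s) mvar R e) -> mdeg m = size s.
Proof.
elim: s m => [|e s IH] m; first by rewrite big_nil msupp1 inE => /eqP->; rewrite mdeg0.
rewrite big_cons => /msuppM_le /allpairsP [[m1 m2] /= [m1P /IH m2P ->]].
move: m1P; rewrite mdegD m2P msuppX inE => /eqP->.
by rewrite mdeg1.
Qed.

Lemma coef_row_pairs : odd n ->
  exists2 d : 'X_{1..#|{: T}|}, (forall e, d (enum_rank e) <= n')%N &
    (cpoly {poly int} (row_pairs n'))@_d != 0.
Proof.
move=> on; pose t (c : 'I_n) : {poly int} := 'X^c.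
have t_inj : injective t.
  by move=> c c' /(congr1 (fun p : {poly int} => size p)); rewrite !size_polyXn => -[/val_inj].
pose M := \prod_(e <- triangle) mvar {poly int} e.
have := latin_coef (M := M) t_inj on.
case/(_ _ _)/mcoeffM_neq0.
- by move=> m /mdeg_prod_mvar ->; rewrite size_triangle.
- have evM a : M.@[fun i => t (a (enum_val i))] = 'X^(weight a).
    rewrite weightE expr_sum rmorph_prod; apply: eq_bigr => e _.
    exact: (meval_mvar t a e).
  (* In the coefficient of this power of the indeterminate only the term of [anticyclic] remains, a
     product of signs. *)
  apply/negP => /eqP /(congr1 (fun p : {poly int} => p`_(weight anticyclic))).
  rewrite coef0 coef_sum (bigD1 anticyclic) //= [X in _ + X]big1 ?addr0.
    rewrite evM mulrzl coefMrz coefXn eqxx -mulrzr mul1r => /eqP.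
    rewrite intz prodf_seq_eq0 => /hasP[r _] /=.
    by rewrite (negPf (_ : sgf _ != 0)) // sgf_neq0; apply/injectiveP/anticyclic_inj.
  move=> a ne; rewrite evM mulrzl coefMrz coefXn.
  case: eqP => [aw|_]; last by rewrite mul0rz.
  have [/forallP rI|/forallPn[r rN]] := boolP [forall r, injectiveb (fun j => a (up r j))].
    by case/eqP: ne; apply: weight_min_uniq => // r; apply/injectiveP.
  rewrite (bigD1 r) //=.
  have /eqP-> : sgf (fun j => a (up r j)) == 0.
    by apply: contraNT rN; rewrite sgf_neq0.
  by rewrite mul0r.
(* Removing the factor [M] only lowers exponents. *)
move=> m1 [m2 [E nz _]]; exists m1 => // e.
have /mnmP/(_ (enum_rank e)) := E; rewrite !mnmE => H.
exact: leq_trans (leq_addr _ _) (eq_leq (esym H)).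
Qed.

Lemma up_set_inj (u v u' v' : 'I_n) : up u v = up u' v' -> [set u; v] = [set u'; v'].
Proof. by move/up_inj=> [[-> ->]|[-> ->]] //; rewrite setUC. Qed.

Lemma online_complete_odd k : odd n -> online_colorable (n + 2 * k) (fun=> k) (complete n).
Proof.
move=> on; have [d dle nz] := coef_row_pairs on.
apply: (online_of_cpoly (phi := @up n) (@upC n) _ _ _ nz).
- by move=> u v u' v' _ _; apply: up_set_inj.
- by move=> u v w _ _ vw; apply: row_pairs_conflict.
- move=> u v _; apply: (@leq_ltn_trans (n' + k + k)); last by lia.
  by rewrite !leq_add2r; apply: dle.
Qed.

End OddComplete.

(** * Complete graphs of prime degree *)

Lemma natr_modp (p : nat) : prime p ->
  forall a b : nat, a = b %[mod p] -> (a%:R = b%:R :> 'F_p)%R.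
Proof. by move=> pp a b E; rewrite -(Fp_nat_mod pp a) E Fp_nat_mod. Qed.

Lemma natr_Fp_inj (p : nat) : prime p ->
  forall a b : nat, a < p -> b < p -> (a%:R = b%:R :> 'F_p)%R -> a = b.
Proof.
move=> pp a b ap bp /(congr1 val).
by rewrite /= !val_Fp_nat // !modn_small.
Qed.

Section PeriodicSum.
Import GRing.Theory.
Local Open Scope ring_scope.
Variables (p : nat) (X : finType) (tau : X -> X) (F : X -> 'F_p).
Hypotheses (p_pr : prime p) (tauP : forall x, iter p tau x = x).
Hypothesis F_tau : forall x, F (tau x) = F x.

(* The orbits of [tau] that are not fixed points have [p] elements. *)
Lemma sum_periodic : \sum_x F x = \sum_(x | tau x == x) F x.
Proof.
have tauI : injective tau.
  move=> x y E; rewrite -(tauP x) -(tauP y).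
  by rewrite -(prednK (prime_gt0 p_pr)) !iterSr E.
pose s := perm tauI.
have sp : (s ^+ p = 1)%g.
  by apply/permP => x; rewrite permX perm1 -[RHS](tauP x); apply: eq_iter => y; rewrite permE.
have pG : (p.-group <[s]>)%g.
  rewrite /pgroup -orderE; apply: (@pnat_dvd _ p); last exact: pnat_id.
  by rewrite order_dvdn sp.
have byval (P : pred X) : \sum_(x | P x) F x = \sum_v v *+ #|[set x | P x && (F x == v)]|.
  rewrite (partition_big F predT) //=; apply: eq_bigr => v _.
  rewrite (eq_bigr (fun=> v)) => [|x /andP[_ /eqP-> //]].
  by rewrite sumr_const; congr (_ *+ _); apply: eq_card => x; rewrite inE.
rewrite (byval predT) byval; apply: eq_bigr => v _.
rewrite -[v *+ _]mulr_natr -[RHS]mulr_natr; congr (_ * _); apply: natr_modp => //.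
have /(pgroup_fix_mod pG) -> : ([acts <[s]>, on [set x | true && (F x == v)] | 'P])%g.
  by rewrite cycle_subG; apply/astabsP => x; rewrite !inE /= /aperm permE F_tau.
rewrite afix_cycle; congr (_ %% _)%N; apply: eq_card => x.
by rewrite !inE /= sub1set inE /= /aperm permE andbC.
Qed.

End PeriodicSum.

(** * Power sums and top coefficients *)

Section PowerSum.
Import GRing.Theory.
Local Open Scope ring_scope.
Variable F : finFieldType.

Lemma sum_exp_small k : (0 < k < #|F|.-1)%N -> \sum_(x : F) x ^+ k = 0.
Proof.
case/andP=> k0 kF.
(* The equation x^k = 1 has at most k roots, fewer than there are nonzero elements. *)
have [g g0 gk] : exists2 g : F, g != 0 & g ^+ k != 1.
  apply/exists_inP; apply: contraTT kF => /exists_inPn H.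
  rewrite -leqNgt -(cardC1 (0 : F)) cardE; apply: max_unity_roots => //.
    by apply/allP => x; rewrite mem_enum => /H; rewrite negbK unity_rootE.
  exact: enum_uniq.
have E : \sum_(x : F) x ^+ k = g ^+ k * \sum_(x : F) x ^+ k.
  rewrite mulr_sumr (reindex_inj (mulfI g0)) /=.
  by apply: eq_bigr => x _; rewrite exprMn.
move/eqP: E; rewrite -subr_eq0 -{1}[\sum_x _]mul1r -mulrBl mulf_eq0 subr_eq0 eq_sym.
by rewrite (negPf gk) /= => /eqP.
Qed.

Lemma sum_exp_top : (1 < #|F|)%N -> \sum_(x : F) x ^+ #|F|.-1 = -1.
Proof.
move=> F1; have Fp : (0 < #|F|.-1)%N by rewrite -subn1 subn_gt0.
rewrite (bigD1 0) //= expr0n gtn_eqF // add0r (eq_bigr (fun=> 1)) => [|x x0].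
  rewrite sumr_const; have -> : #|[pred x : F | x != 0]| = #|F|.-1 by rewrite (cardC1 (0 : F)).
  have F0 : (#|F|%:R = 0 :> F).
    apply: (@addrI _ (\sum_(x : F) x)); rewrite addr0 [RHS](reindex_inj (addIr 1)) /=.
    by rewrite big_split /= sumr_const.
  by apply/eqP; rewrite -subr_eq0 opprK -mulrSr prednK ?(ltnW F1) // F0.
by apply: (mulfI x0); rewrite -exprS prednK ?(ltnW F1) // expf_card mulr1.
Qed.

End PowerSum.

Section TopCoefficient.
Import GRing.Theory.
Local Open Scope ring_scope.
Variables (R : comNzRingType) (N : nat) (I : eqType) (L : I -> {mpoly R[N]}) (c : I -> R).
Hypothesis degL : forall i m, m \in msupp (L i) -> (mdeg m <= 1)%N.

Lemma mdeg_prod_affine (s : seq I) m :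
  m \in msupp (\prod_(i <- s) (L i + (c i)%:MP)) -> (mdeg m <= size s)%N.
Proof.
elim: s m => [|i s IH] m; first by rewrite big_nil msupp1 inE => /eqP->; rewrite mdeg0.
rewrite big_cons => /msuppM_le /allpairsP [[m1 m2] /= [m1P /IH m2P ->]].
rewrite mdegD -add1n leq_add // {m2 m2P}.
move/msuppD_le: m1P; rewrite mem_cat => /orP[/degL //|].
by rewrite msuppC; case: ifP => // _; rewrite inE => /eqP->; rewrite mdeg0.
Qed.

(** Replacing the affine factors one by one by their parts [L i] changes the product only in degrees
    below the number of factors. *)
Lemma mcoeff_prod_affine (s : seq I) m : (size s <= mdeg m)%N ->
  (\prod_(i <- s) (L i + (c i)%:MP))@_m = (\prod_(i <- s) L i)@_m.
Proof.
move=> sm; apply/eqP; rewrite -subr_eq0 -mcoeffB mcoeff_eq0.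
suff H m' : m' \in msupp (\prod_(i <- s) (L i + (c i)%:MP) - \prod_(i <- s) L i) ->
    (mdeg m' < size s)%N by apply/negP => /H; rewrite ltnNge sm.
elim: s {sm} m' => [|i s IH] m' /=; first by rewrite !big_nil subrr msupp0.
rewrite !big_cons; set A := \prod_(j <- s) _; set B := \prod_(j <- s) _.
have -> : (L i + (c i)%:MP) * A - L i * B = L i * (A - B) + c i *: A.
  by rewrite -mul_mpolyC; ring.
move/msuppD_le; rewrite mem_cat => /orP[].
  move=> /msuppM_le /allpairsP [[m1 m2] /= [/degL m1P /IH m2P ->]].
  by rewrite mdegD; move: m1P m2P => /=; lia.
by move/msuppZ_le/mdeg_prod_affine.
Qed.

End TopCoefficient.

(** Any two values differ by at least 2, so their halves exhaust 0, ..., h and, from the top down,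
    the values are 2h, ..., 2, 0. The last exclusion forbids a value to come before the one smaller
    by 2, so they increase. *)
Lemma spaced_unique h (x : 'I_h.+1 -> nat) :
  (forall d, x d <= h.*2) ->
  (forall d e : 'I_h.+1, d < e ->
     [/\ x e != x d, x e != (x d).+1, x d != (x e).+1 & x d != (x e).+2]) ->
  forall d, x d = d.*2.
Proof.
move=> xh sp; pose y d : 'I_h.+1 := inord (x d)./2.
have yE d : y d = (x d)./2 :> nat by rewrite inordK // ltnS; have := xh d; lia.
have yI : injective y.
  move=> d e /(congr1 val) /=; rewrite !yE => E; apply: val_inj => /=.
  by case: (ltngtP d e) => // /sp [] *; lia.
have [z yK zK] := injF_bij yI.
have zE k : (x (z k))./2 = k by rewrite -yE zK.
have zx k : k <= h -> x (z (inord (h - k))) = (h - k).*2.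
  elim: k => [|k IH] kh.
    by have := xh (z (inord (h - 0))); have := zE (inord (h - 0)); rewrite inordK; lia.
  have := IH (ltnW kh); have := zE (inord (h - k.+1)); rewrite inordK; last by lia.
  have [lt|lt|/val_inj E] := ltngtP (z (inord (h - k.+1))) (z (inord (h - k))).
  - by have [] := sp _ _ lt; lia.
  - by have [] := sp _ _ lt; lia.
  - by have := zE (inord (h - k)); rewrite -E => ->; rewrite inordK; lia.
have xz (k : 'I_h.+1) : x (z k) = k.*2.
  by have := zx (h - k) (leq_subr _ _); rewrite subKn ?inord_val // -ltnS.
have zmono (k l : 'I_h.+1) : l = k.+1 :> nat -> z k < z l.
  move=> lk; have := xz k; have := xz l; rewrite lk.
  have [//|lt|/val_inj->] := ltngtP (z k) (z l); last by lia.
  by have [] := sp _ _ lt; lia.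
have zge k (kh : k <= h) : k <= z (inord k).
  elim: k kh => // k IH kh; apply: leq_ltn_trans (IH (ltnW kh)) (zmono _ _ _).
  by rewrite !inordK //; lia.
have zle k (kh : k <= h) : z (inord (h - k)) <= h - k.
  elim: k kh => [|k IH] kh; first by rewrite subn0 -ltnS.
  have := zmono (inord (h - k.+1)) (inord (h - k)).
  by rewrite !inordK; have := IH (ltnW kh); lia.
move=> d; have zd : z d = d.
  apply: val_inj; apply/eqP; rewrite eqn_leq -{1}[d]inord_val /=.
  have dh : d <= h by rewrite -ltnS.
  have := zge d dh; have := zle (h - d) (leq_subr _ _).
  by rewrite subKn // inord_val => -> ->.
by rewrite -{1}zd xz.
Qed.

(** * Starters and the Dyson constant term *)

Section StarterSum.
Import GRing.Theory.
Local Open Scope ring_scope.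
Variable h' : nat.
Notation h := h'.+1.
Notation n := h'.*2.+3.
Hypothesis n_pr : prime n.
Notation t := (fun c : 'I_n => c%:R : 'F_n).

Lemma natr_ord_inj : injective t.
Proof. by move=> c d /(natr_Fp_inj n_pr (ltn_ord c) (ltn_ord d)) /val_inj. Qed.

Lemma natr_ordD (c d : 'I_n) : t (c + d) = t c + t d.
Proof. by rewrite -natrD; apply: natr_modp => //=; rewrite modn_mod. Qed.

Lemma natr_Fp0 : n%:R = 0 :> 'F_n.
Proof. by rewrite -[RHS]/(0%:R); apply: natr_modp => //; rewrite modnn mod0n. Qed.

(** Index of the pair {k, -k} of nonzero residues; the value at 0 is a default. *)
Definition fold (k : 'I_n) : 'I_h := inord (if (k <= h)%N then k.-1 else (n - k).-1).

Lemma foldE (k : 'I_n) : k != 0 ->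
  fold k = (if (k <= h)%N then k.-1 else (n - k).-1) :> nat.
Proof.
rewrite -val_eqE /= => k0; rewrite inordK //.
by have := ltn_ord k; case: ifP; lia.
Qed.

(* The functions [f] with [f 0 = 0] and [f (- k) = f k - k], parametrized by
   their free values [f 1, ..., f h]. *)
Definition starter (x : {ffun 'I_h -> 'I_n}) (k : 'I_n) : 'I_n :=
  if k == 0 then 0 else x (fold k) + (if (k <= h)%N then 0 else k).

Lemma val_ord_opp (k : 'I_n) : k != 0 -> (- k : 'I_n) = (n - k)%N :> nat.
Proof.
rewrite -val_eqE /= => k0; rewrite modn_small //; have := ltn_ord k; lia.
Qed.

Lemma fold_opp (k : 'I_n) : fold (- k) = fold k.
Proof.
have [->|k0] := eqVneq k 0; first by rewrite oppr0.
apply: val_inj; rewrite /= !foldE ?oppr_eq0 // val_ord_opp //.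
by have := ltn_ord k; move: k0; rewrite -val_eqE /=; do 2!case: ifP; lia.
Qed.

Lemma starter_opp x k : starter x (- k) = starter x k - k.
Proof.
rewrite /starter oppr_eq0; have [->|k0] := eqVneq k 0; first by rewrite subr0.
rewrite fold_opp -addrA; congr (_ + _); rewrite val_ord_opp //.
have := ltn_ord k; case: ifP; case: ifP; rewrite ?subrr ?add0r //; lia.
Qed.

Definition lin (k : 'I_n) : {mpoly 'F_n[#|'I_h|]} :=
  if k == 0 then 0 else mvar _ (fold k).

Definition linval (x : {ffun 'I_h -> 'I_n}) (k : 'I_n) : nat :=
  if k == 0 then 0%N else x (fold k).

Definition shift (k : 'I_n) : 'F_n := if (k <= h)%N then 0 else t k.

Lemma t_starter x k : t (starter x k) = (linval x k)%:R + shift k.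
Proof.
rewrite /starter /linval /shift; case: eqP => [->|_] /=; first by rewrite addr0.
by rewrite natr_ordD; case: ifP.
Qed.

Notation ev x := (fun i => t (x (enum_val i))).

Lemma meval_lin (x : {ffun 'I_h -> 'I_n}) k : (lin k).@[ev x] = (linval x k)%:R.
Proof.
rewrite /lin /linval; case: eqP => _; first by rewrite meval0.
by rewrite mevalXU enum_rankK.
Qed.

Lemma mdeg_lin k m : m \in msupp (lin k) -> (mdeg m <= 1)%N.
Proof.
rewrite /lin; case: eqP => _; first by rewrite msupp0.
by rewrite msuppX inE => /eqP->; rewrite mdeg1.
Qed.

(** For j + k = n the difference of the values of a starter does not depend on [x]. Removing these h
    pairs leaves h(n-1) factors, the top degree on the grid. *)
Definition crossing := [seq q : 'I_n * 'I_n <- enum (ltpair n) | (q.1 + q.2 != n :> nat)%N].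

Lemma size_crossing : (size crossing <= #|'I_h| * h'.*2.+2)%N.
Proof.
pose opposite := [pred q : 'I_n * 'I_n | q.1 + q.2 == n :> nat]%N.
have E : (count opposite (enum (ltpair n)) + size crossing = #|ltpair n|)%N.
  by rewrite size_filter cardE -(count_predC opposite (enum _)).
have : (h <= count opposite (enum (ltpair n)))%N.
  rewrite -size_filter -[X in (X <= _)%N](card_ord h).
  pose g (d : 'I_h) : 'I_n * 'I_n := (inord d.+1, inord (n - d.+1)).
  have gE (d : 'I_h) : ((g d).1 = d.+1 :> nat) * ((g d).2 = n - d.+1 :> nat)%N.
    by rewrite !inordK //; have := ltn_ord d; lia.
  have gI : injective g.
    by move=> d e /(congr1 (fun q => val q.1)) /=; rewrite !gE => -[/val_inj].
  rewrite cardE -(size_map g); apply: uniq_leq_size.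
    by rewrite map_inj_uniq ?enum_uniq.
  move=> _ /mapP[d _ ->]; rewrite mem_filter mem_enum !inE !gE.
  by have := ltn_ord d; lia.
by have := card_ltpair n; rewrite card_ord; nia.
Qed.

(** The moments of the field vanish below n - 1, so the sum extracts a top coefficient, which is
    blind to the constants [c]. *)
Lemma sum_prod_affine (c : 'I_n * 'I_n -> 'F_n) :
  \sum_(x : {ffun 'I_h -> 'I_n})
     \prod_(q <- crossing) ((linval x q.2)%:R - (linval x q.1)%:R + c q) =
  (-1) ^+ #|'I_h| *
   (\prod_(q <- crossing) (lin q.2 - lin q.1))@_[multinom h'.*2.+2 | _ < #|'I_h|].
Proof.
have degL q m : m \in msupp (lin q.2 - lin q.1) -> (mdeg m <= 1)%N.
  by move/msuppB_le; rewrite mem_cat => /orP[]/mdeg_lin.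
have moment k : (k <= h'.*2.+2)%N ->
    \sum_(d : 'I_n) 1 * t d ^+ k = if k == h'.*2.+2 then -1 else 0.
  have cF := card_Fp n_pr.
  have tB : bijective t.
    by apply: inj_card_bij; [exact: natr_ord_inj | rewrite cF card_ord].
  have -> : \sum_(d : 'I_n) 1 * t d ^+ k = \sum_(y : 'F_n) y ^+ k.
    rewrite [RHS](reindex _ (onW_bij _ tB)) /=.
    by apply: eq_bigr => d _; rewrite mul1r.
  case: (eqVneq k h'.*2.+2) => [->|kn] kle.
    by have := @sum_exp_top 'F_n; rewrite cF; apply.
  case: k kn kle => [|k] kn kle.
    by rewrite (eq_bigr (fun=> 1)) // sumr_const cF natr_Fp0.
  by apply: sum_exp_small; rewrite cF /=; lia.
rewrite -(mcoeff_prod_affine c degL); last first.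
  rewrite mdegE; under eq_bigr do rewrite mnmE.
  by rewrite sum_nat_const [X in (_ <= X * _)%N]card_ord; apply: size_crossing.
rewrite -(grid_sum moment); last first.
  move=> m /(mdeg_prod_affine degL) le; exact: leq_trans le size_crossing.
apply: eq_bigr => x _; rewrite prodr_const expr1n mul1r rmorph_prod.
apply: eq_bigr => q _.
by rewrite rmorphD rmorphB /= mevalC !(meval_lin x).
Qed.

(** The shifted factor is [upper - lower]. Both sides are natural numbers, so that at the surviving
    point vanishing modulo n becomes equality of numbers below n. *)
Definition upper (x : {ffun 'I_h -> 'I_n}) (q : 'I_n * 'I_n) : nat :=
  (linval x q.2 + if q.1 == 0%R then (h < q.2).+1 else 0)%N.

Definition lower (x : {ffun 'I_h -> 'I_n}) (q : 'I_n * 'I_n) : nat :=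
  (linval x q.1 + if q.1 == 0%R then 0 else (h < q.1) + (h < q.2))%N.

(* Only one point of the grid contributes when the constant terms are those of
   Karasev and Petrov's evaluation of the Dyson constant term. *)
Lemma sum_dyson_neq0 :
  \sum_(x : {ffun 'I_h -> 'I_n})
     \prod_(q <- crossing) ((upper x q)%:R - (lower x q)%:R : 'F_n) != 0.
Proof.
pose x0 : {ffun 'I_h -> 'I_n} := [ffun d : 'I_h => inord d.*2].
have x0E d : x0 d = d.*2 :> nat by rewrite ffunE inordK //; have := ltn_ord d; lia.
rewrite (bigD1 x0) //= [X in _ + X]big1 ?addr0 => [|x xx0].
  rewrite prodf_seq_neq0; apply/allP => -[j k].
  rewrite mem_filter mem_enum !inE /= => /andP[jk_n jk].
  have k1 : (0 < k)%N by apply: leq_ltn_trans jk.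
  have k0 : k != 0 by rewrite -val_eqE /= -lt0n.
  have kn := ltn_ord k.
  rewrite subr_eq0; apply/eqP => /(natr_Fp_inj n_pr); rewrite /upper /lower /linval /=.
  rewrite (negPf k0) !x0E foldE //.
  have [_|j0] := eqVneq j 0.
    by case: (leqP k h) => ? /= H; (have := H ltac:(lia) ltac:(lia)); lia.
  rewrite foldE //; have j1 : (0 < j)%N by rewrite lt0n.
  by case: (leqP k h) => ?; case: (leqP j h) => ? /= H;
     (have := H ltac:(lia) ltac:(lia)); lia.
apply/eqP; apply: contraNT xx0; rewrite prodf_seq_neq0 => /allP nz.
have key (j k : nat) : (j < k < n)%N -> (j + k != n)%N ->
    (upper x (inord j, inord k))%:R != (lower x (inord j, inord k))%:R :> 'F_n.
  move=> /andP[jk kn] jkn; have jn := ltn_trans jk kn.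
  have /nz : (inord j, inord k) \in crossing.
    by rewrite mem_filter mem_enum !inE /= !inordK // jkn.
  by rewrite /= subr_eq0.
pose X (d : 'I_h) : nat := x d.
have ordE (k : nat) : (k < n)%N -> (inord k == 0 :> 'I_n) = (k == 0)%N.
  by move=> kn; rewrite -val_eqE /= inordK.
have lv (d : 'I_h) : linval x (inord d.+1) = X d /\ linval x (inord (n - d.+1)) = X d.
  have dh := ltn_ord d.
  have E k : (k < n)%N -> (k != 0)%N -> (if (k <= h)%N then k.-1 else (n - k).-1) = d :> nat ->
      linval x (inord k) = X d.
    move=> kn k0 kd; rewrite /linval ordE // (negPf k0) /X; congr (nat_of_ord (x _)).
    by apply: val_inj; rewrite /= foldE ?ordE // inordK.
  by split; apply: E; rewrite ?leqnn; try lia; case: ifP; lia.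
have lv1 (d : 'I_h) := (lv d).1; have lv2 (d : 'I_h) := (lv d).2.
have lv0 : linval x (inord 0) = 0%N by rewrite /linval ordE.
(* The factors with j = 0 are X d + 1 and X d + 2; they rule out the values n - 1 and n - 2. *)
have Xle (d : 'I_h) : (X d <= h'.*2)%N.
  have dh := ltn_ord d; have := ltn_ord (x d); rewrite -/(X d).
  have := key 0%N d.+1 ltac:(lia) ltac:(lia).
  have := key 0%N (n - d.+1)%N ltac:(lia) ltac:(lia).
  rewrite /upper /lower /= !ordE // lv1 lv2 lv0 !inordK //; try lia.
  rewrite (_ : h < n - d.+1)%N; last by lia.
  rewrite (_ : (h < d.+1)%N = false); last by lia.
  have [->|n2] := eqVneq (X d + 2)%N n; first by rewrite natr_Fp0 eqxx.
  have [->|n1 _ _] := eqVneq (X d + 1)%N n; first by rewrite natr_Fp0 eqxx.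
  by lia.
(* Two pairs of opposite residues give four factors, one for each exclusion. *)
have Xsp (d e : 'I_h) : (d < e)%N ->
    [/\ X e != X d, X e != (X d).+1, X d != (X e).+1 & X d != (X e).+2].
  move=> de; have dh := ltn_ord d; have eh := ltn_ord e.
  have use (j k : nat) a b c : (j < k < n)%N -> (0 < j)%N -> (j + k != n)%N ->
      linval x (inord j) = b -> linval x (inord k) = a ->
      ((h < j) + (h < k) = c)%N -> a != (b + c)%N.
    move=> jkn j0 jk Ej Ek Ec; have := key j k jkn jk.
    have [jlt klt] : (j < n)%N /\ (k < n)%N by lia.
    rewrite /upper /lower /= ordE // (gtn_eqF j0) Ej Ek !inordK // Ec addn0.
    by apply: contraNneq => ->.
  have H1 := use d.+1 e.+1 _ _ 0%N ltac:(lia) isT ltac:(lia) (lv1 d) (lv1 e) ltac:(lia).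
  have H2 := use d.+1 (n - e.+1)%N _ _ 1%N ltac:(lia) isT ltac:(lia) (lv1 d) (lv2 e) ltac:(lia).
  have H3 := use e.+1 (n - d.+1)%N _ _ 1%N ltac:(lia) isT ltac:(lia) (lv1 e) (lv2 d) ltac:(lia).
  have H4 := use (n - e.+1)%N (n - d.+1)%N _ _ 2%N ltac:(lia) ltac:(lia) ltac:(lia)
    (lv2 e) (lv2 d) ltac:(lia).
  by move: H1 H2 H3 H4; rewrite addn0 addn1 addn1 addn2.
by apply/eqP/ffunP => d; apply: val_inj; rewrite /= x0E; apply: (spaced_unique Xle Xsp).
Qed.

(** The pairs j + k = n contribute the nonzero constant [C]; in the other factors [sum_prod_affine],
    used in both directions, exchanges the constant terms for those of [sum_dyson_neq0]. *)
Lemma starter_sum_neq0 :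
  \sum_(x : {ffun 'I_h -> 'I_n}) vdm (t \o starter x) != 0.
Proof.
pose C := \prod_(q in ltpair n | (q.1 + q.2 == n :> nat)%N) (shift q.2 - shift q.1).
have vdm_C (x : {ffun 'I_h -> 'I_n}) : vdm (t \o starter x) = C *
    \prod_(q <- crossing) ((linval x q.2)%:R - (linval x q.1)%:R + (shift q.2 - shift q.1)).
  rewrite vdmE (bigID (fun q : 'I_n * 'I_n => q.1 + q.2 == n :> nat)%N) /=.
  congr (_ * _).
    apply: eq_bigr => -[j k] /= /andP[]; rewrite inE /= => jk /eqP jkn.
    have j0 : j != 0 by rewrite -val_eqE /=; have := ltn_ord k; lia.
    have kE : k = - j by apply: ord_inj; rewrite val_ord_opp //; lia.
    rewrite !t_starter kE /linval oppr_eq0 (negPf j0) fold_opp.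
    by rewrite opprD addrACA subrr add0r.
  rewrite big_filter big_enum_cond. apply: eq_bigr => q _.
  by rewrite !t_starter opprD addrACA.
have C0 : C != 0.
  apply/prodf_neq0 => -[j k] /= /andP[]; rewrite inE /= => jk /eqP jkn.
  have jh : (j <= h)%N by lia.
  have kh : (k <= h)%N = false by lia.
  rewrite /shift jh kh subr0 -[0 in X in _ != X]/(t 0) (inj_eq natr_ord_inj) -val_eqE /=; lia.
under eq_bigr do rewrite vdm_C.
rewrite -mulr_sumr mulf_neq0 //.
rewrite (sum_prod_affine (fun q => shift q.2 - shift q.1)).
pose c2 (q : 'I_n * 'I_n) : 'F_n :=
  (if q.1 == 0%R then (h < q.2).+1 else 0)%N%:R -
  (if q.1 == 0%R then 0 else (h < q.1) + (h < q.2))%N%:R.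
rewrite -(sum_prod_affine c2).
have := sum_dyson_neq0; congr (_ != _).
apply: eq_bigr => x _; apply: eq_bigr => q _.
by rewrite /upper /lower !natrD opprD addrACA.
Qed.

End StarterSum.

(** * Signed sums over idempotent squares modulo a prime *)

Section IdempotentSum.
Import GRing.Theory Num.Theory.
Local Open Scope ring_scope.
Variable h' : nat.
Notation h := h'.+1.
Notation n := h'.*2.+3.
Hypothesis n_pr : prime n.
Notation T := (upair n).
Notation t := (fun c : 'I_n => c%:R : 'F_n).
Implicit Types (b : {ffun T -> 'I_n}) (x : {ffun 'I_h -> 'I_n}).

Definition rowsign b : int := \prod_r sgf (fun j => b (up r j)).

Definition idempotent b := [forall i, b (up i i) == i].

Lemma sgf_conj (f : 'I_n -> 'I_n) c : sgf (fun j => f (j - c) + c) = sgf f.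
Proof.
pose s (j : 'I_n) := j - c; pose a (j : 'I_n) := j + c.
have sa : sgf s * sgf a = 1.
  by rewrite -sgf_comp -[RHS](sgf_id n); apply: eq_sgf => j; rewrite /= /a /s subrK.
by rewrite -[LHS]/(sgf (a \o (f \o s))) 2!sgf_comp mulrAC sa mul1r.
Qed.

Lemma sgf_odd_exp (f : 'I_n -> 'I_n) : sgf f ^+ n = sgf f.
Proof.
have [/injectiveP fI|nI] := boolP (injectiveb f).
  have E k : sgf f ^+ k.*2.+1 = sgf f.
    by rewrite exprS -(mul2n k) exprM expr2 sgf_sqr // expr1n mulr1.
  exact: (E h).
have /eqP-> : sgf f == 0 by apply: contraNT nI; rewrite sgf_neq0.
by rewrite expr0n.
Qed.

Definition translate b : {ffun T -> 'I_n} :=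
  [ffun e : T => b (up ((val e).1 - 1) ((val e).2 - 1)) + 1].

Lemma translateE b i j : translate b (up i j) = b (up (i - 1) (j - 1)) + 1.
Proof. by rewrite ffunE /= /osort; case: ifP => //= _; rewrite upC. Qed.

Lemma iter_translate k b i j :
  iter k translate b (up i j) = b (up (i - k%:R) (j - k%:R)) + k%:R.
Proof.
elim: k i j => [|k IH] i j; first by rewrite !subr0 addr0.
by rewrite iterS translateE IH -addrA -mulrSr -!addrA -!opprD -mulrS.
Qed.

Lemma ffun_upairP b b' : (forall i j, b (up i j) = b' (up i j)) -> b = b'.
Proof. by move=> E; apply/ffunP => e; rewrite -(up_val e). Qed.

Lemma translate_period b : iter n translate b = b.
Proof.
apply: ffun_upairP => i j; rewrite iter_translate.
by rewrite (pchar_Zp (p := n)) // !subr0 addr0.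
Qed.

Lemma rowsign_translate b : rowsign (translate b) = rowsign b.
Proof.
rewrite /rowsign [RHS](reindex_inj (addIr (- 1))) /=; apply: eq_bigr => r _.
rewrite -[RHS](sgf_conj _ 1); apply: eq_sgf => j; exact: translateE.
Qed.

Lemma idempotent_translate b : idempotent (translate b) = idempotent b.
Proof.
apply/forallP/forallP => H i.
  have := H (i + 1); rewrite translateE addrK.
  by rewrite (inj_eq (addIr 1)).
by rewrite translateE (eqP (H _)) subrK.
Qed.

Lemma translate_fixedP b : translate b = b ->
  forall i j, b (up i j) = b (up 0 (j - i)) + i.
Proof.
move=> fx i j; have iterfx k : iter k translate b = b by elim: k => //= k ->.
by rewrite -{1}(iterfx i) iter_translate natr_Zp subrr.
Qed.

Definition unstarter b : {ffun 'I_h -> 'I_n} := [ffun d : 'I_h => b (up 0 (inord d.+1))].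

Definition cyclic_square x : {ffun T -> 'I_n} :=
  [ffun e : T => starter x ((val e).2 - (val e).1) + (val e).1].

Lemma cyclic_squareE x i j : cyclic_square x (up i j) = starter x (j - i) + i.
Proof.
rewrite ffunE /= /osort; case: ifP => //= _.
by rewrite -(opprB j i) starter_opp // opprB addrA subrK.
Qed.

Lemma idempotent_sum_neq0 : \sum_(b | idempotent b) rowsign b != 0.
Proof.
(* Nonvanishing is checked modulo n, and the factor [vdm t] turns signs of starters into Vandermonde
   determinants. *)
suff : (\sum_(b | idempotent b) rowsign b)%:~R * vdm t != 0 :> 'F_n.
  by apply: contraNneq => ->; rewrite mul0r.
have -> : (\sum_(b | idempotent b) rowsign b)%:~R =
    \sum_(b | (translate b == b) && idempotent b) (rowsign b)%:~R :> 'F_n.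
  rewrite (rmorph_sum intr) big_mkcond [RHS]big_mkcondr /=.
  apply: (sum_periodic n_pr translate_period) => b.
  by rewrite idempotent_translate rowsign_translate.
rewrite mulr_suml.
have E : \sum_(x : {ffun 'I_h -> 'I_n}) vdm (t \o starter x) != 0 by exact: starter_sum_neq0.
move: E; congr (_ != _); apply/esym.
rewrite (reindex_onto cyclic_square unstarter) /=.
  apply: eq_big => [x|x _].
    apply/andP; split; first (apply/andP; split).
    - apply/eqP/ffun_upairP => i j; rewrite translateE !cyclic_squareE.
      by rewrite -addrA subrK opprB addrA subrK.
    - by apply/forallP => i; rewrite cyclic_squareE subrr /starter eqxx add0r.
    apply/eqP/ffunP => d; rewrite ffunE cyclic_squareE subr0 addr0.
    have dh := ltn_ord d.
    have dn : val (inord d.+1 : 'I_n) = d.+1 by rewrite /= inordK //; lia.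
    have d0 : (inord d.+1 : 'I_n) != 0 by rewrite -val_eqE dn.
    rewrite /starter (negPf d0) -/(val _) dn dh addr0; congr (x _).
    by apply: val_inj; rewrite /= foldE // -/(val _) dn dh.
  (* All n rows are conjugates of the starter under translations and have its sign; n is odd. *)
  rewrite vdm_sgf mulrC -(sgf_odd_exp (starter x)); congr (_ * _%:~R).
  rewrite /rowsign -[X in _ = _ ^+ X]card_ord -prodr_const; apply: eq_bigr => r _.
  rewrite -[RHS](sgf_conj _ r); apply: eq_sgf => j; exact: cyclic_squareE.
move=> b /andP[/eqP fx /forallP idem]; apply: ffun_upairP => i j.
rewrite cyclic_squareE (translate_fixedP fx); congr (_ + _).
move: (j - i) => {i j} k; rewrite /starter; have [->|k0] := eqVneq k 0.
  by rewrite (eqP (idem 0)).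
rewrite ffunE foldE //; case: ifP => kh.
  by rewrite addr0 prednK ?inord_val // lt0n.
have -> : inord (n - k).-1.+1 = - k.
  by apply: ord_inj; rewrite val_ord_opp // inordK; have := ltn_ord k; lia.
by rewrite upC (translate_fixedP fx) sub0r opprK subrK.
Qed.

(** Relabeling the symbols by the permutation [s] on the diagonal multiplies the n row signs by
    [sgf s ^+ n = sgf s], which cancels the diagonal sign; each [s] thus contributes the sum over
    idempotent squares. *)
Lemma diagonal_sum_neq0 :
  \sum_(a : {ffun T -> 'I_n}) rowsign a * sgf (fun j => a (up j j)) != 0.
Proof.
pose diag_is (s : 'S_n) (a : {ffun T -> 'I_n}) := [forall i, a (up i i) == s i].
have split_diag a : rowsign a * sgf (fun j => a (up j j)) =
    \sum_(s : 'S_n | diag_is s a) rowsign a * sgf s.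
  have [dI|dN] := boolP (injectiveb (fun j => a (up j j))).
    pose s := perm (elimT (injectiveP _) dI).
    rewrite (big_pred1 s) => [|s']; first by congr (_ * _); apply: eq_sgf => i; rewrite permE.
    apply/forallP/eqP => [E|-> i]; last by rewrite permE.
    by apply/permP => i; rewrite permE -(eqP (E i)).
  have /eqP-> : sgf (fun j => a (up j j)) == 0.
    by apply: contraNT dN; rewrite sgf_neq0.
  rewrite mulr0 big_pred0 // => s; apply: contraNF dN => /forallP E.
  by apply/injectiveP => i j; rewrite (eqP (E i)) (eqP (E j)) => /perm_inj.
under eq_bigr do rewrite split_diag.
rewrite (exchange_big_dep predT) //=.
rewrite (eq_bigr (fun=> \sum_(b | idempotent b) rowsign b)) => [|s _].
  by rewrite sumr_const mulrn_eq0 negb_or idempotent_sum_neq0 andbT -lt0n (cardD1 1%g).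
pose relabel (b : {ffun T -> 'I_n}) : {ffun T -> 'I_n} := [ffun e => s (b e)].
have relabelI : injective relabel.
  move=> b b' /ffunP E; apply/ffunP => e.
  by have := E e; rewrite !ffunE => /perm_inj.
rewrite (reindex_inj relabelI) /=; apply: eq_big => [b|b _].
  by apply: eq_forallb => i; rewrite ffunE (inj_eq perm_inj).
have -> : rowsign (relabel b) = rowsign b * sgf s.
  rewrite -(sgf_odd_exp s) /rowsign -[X in _ * _ ^+ X](card_ord n) -prodr_const -big_split /=.
  by apply: eq_bigr => r _; rewrite -sgf_comp; apply: eq_sgf => j; rewrite ffunE.
by rewrite -mulrA sgf_sqr ?mulr1 //; apply: perm_inj.
Qed.

Lemma mcoeff_row_diag_pairs :
  (cpoly int (row_pairs h'.*2.+2 ++ diag_pairs h'.*2.+2))@_(topmn h'.*2.+2) != 0.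
Proof.
pose u (c : 'I_n) : int := (c : nat)%:Z.
have uI : injective u by move=> c d [/val_inj].
rewrite /cpoly big_cat; apply: (latin_coef uI).
- by rewrite /= odd_double.
- by move=> m /mdeg_cpoly ->; rewrite size_diag_pairs.
rewrite (eq_bigr (fun a : {ffun T -> 'I_n} =>
    vdm u * (rowsign a * sgf (fun j => a (up j j))))) => [|a _]; last first.
  by rewrite (meval_diag_pairs u a) !intz mulrCA.
rewrite -mulr_sumr mulf_neq0 ?vdm_neq0 //; exact: diagonal_sum_neq0.
Qed.

End IdempotentSum.

(** * The extra vertex and the upper bound for even order *)

Section PrimeDegree.
Variable n' : nat.
Notation n := n'.+1.
Implicit Types u v w : 'I_n.+1.

(* The edge from [i] to the extra vertex [ord_max] is stored on the diagonal. *)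
Definition star_up u v : upair n :=
  match unlift ord_max u, unlift ord_max v with
  | Some i, Some j => up i j
  | Some i, None => up i i
  | None, Some j => up j j
  | None, None => up ord0 ord0
  end.

Lemma star_upC u v : star_up u v = star_up v u.
Proof. by rewrite /star_up; case: unlift; case: unlift => // *; apply: upC. Qed.

Lemma star_up_inj u v u' v' : u != v -> u' != v' ->
  star_up u v = star_up u' v' -> [set u; v] = [set u'; v'].
Proof.
rewrite /star_up.
case: (unliftP ord_max u) => [i|] ->; case: (unliftP ord_max v) => [j|] ->;
case: (unliftP ord_max u') => [i'|] ->; case: (unliftP ord_max v') => [j'|] ->;
  rewrite ?eqxx ?(inj_eq lift_inj) // => uv uv' /up_inj[] [e1 e2]; subst;
  rewrite ?eqxx // in uv uv' *; exact: setUC.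
Qed.

Lemma star_up_conflict u v w : u != v -> u != w -> v != w ->
  ((star_up u v, star_up u w) \in row_pairs n' ++ diag_pairs n')
  || ((star_up u w, star_up u v) \in row_pairs n' ++ diag_pairs n').
Proof.
move=> uv uw vw; rewrite !mem_cat.
have row r j k : j != k -> [|| ((up r j, up r k) \in row_pairs n')
    || ((up r j, up r k) \in diag_pairs n'), (up r k, up r j) \in row_pairs n'
    | (up r k, up r j) \in diag_pairs n'].
  by move=> /(row_pairs_conflict r) /orP[] -> //; rewrite !orbT.
have diag j k : j != k -> [|| ((up j j, up k k) \in row_pairs n')
    || ((up j j, up k k) \in diag_pairs n'), (up k k, up j j) \in row_pairs n'
    | (up k k, up j j) \in diag_pairs n'].
  have mem (x y : 'I_n) : x < y -> (up y y, up x x) \in diag_pairs n'.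
    by move=> xy; apply/mapP; exists (x, y); rewrite ?mem_enum ?inE.
  by case: (ltngtP j k) => [/mem->|/mem->|/val_inj->]; rewrite ?orbT ?eqxx.
move: uv uw vw; rewrite /star_up.
case: (unliftP ord_max u) => [i|] ->; case: (unliftP ord_max v) => [j|] ->;
case: (unliftP ord_max w) => [k|] ->; rewrite ?eqxx ?(inj_eq lift_inj) // => uv uw vw;
  by [apply: row | apply: row; rewrite eq_sym | apply: diag].
Qed.

End PrimeDegree.

Lemma online_complete_prime p k : prime p -> odd p ->
  online_colorable (p + 2 * k) (fun=> k) (complete p.+1).
Proof.
move=> p_pr op.
have [h Ep] : exists h, p = h.*2.+3.
  by exists (p - 3)./2; have := prime_gt1 p_pr; lia.
rewrite Ep in p_pr *.
have edge_neq u v : [set u; v] \in edges (complete h.*2.+3.+1) -> u != v.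
  by rewrite inE cards2; case: (u != v).
apply: (online_of_cpoly (@star_upC _) (@star_up_inj _) _ _ (mcoeff_row_diag_pairs p_pr)).
  by move=> u v w /edge_neq uv /edge_neq uw; apply: star_up_conflict.
by move=> u v _; rewrite mnmE; lia.
Qed.

Theorem theorem3p7 (t n : nat) (hn : 2 <= n)
    (hn1 : ~~ odd (n - 1) \/ prime (n - 1)) :
  chi_OL (fun=> t) (complete n) =
    if odd n then n + 2 * t else n + 2 * t - 1.
Proof.
rewrite /chi_OL; case: ex_minnP => m col min; apply/eqP; rewrite eqn_leq.
rewrite (online_complete_lower hn col) andbT; apply: min.
case: n hn hn1 {col} => // n hn hn1; rewrite subSS subn0 in hn1.
case: ifP => on; first exact: online_complete_odd.
have on' : odd n by move: on => /= /negbFE.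
have -> : n.+1 + 2 * t - 1 = n + 2 * t by lia.
(* For an even number of vertices the degree is odd, so the hypothesis leaves only the prime
   case. *)
by apply: online_complete_prime => //; case: hn1; rewrite ?on'.
Qed.
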